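(* Assume the eigenvalues $\lambda_1,\dots,\lambda_N$ of $R_r$ are pairwise distinct and the eigenvalues $\sigma_1,\dots,\sigma_N$ of $R_t$ are pairwise distinct, and let all parameters except $\rho$ be fixed. Define $$A(\rho)=\sum_{i=1}^N\sum_{m=1}^N\frac{\lambda_i^{-1}}{\prod_{j\ne i}(\lambda_i-\lambda_j)}\,\frac{\sigma_m^{-1}}{\prod_{n\ne m}(\sigma_m-\sigma_n)}\,\frac{1}{N!}\left[\frac{1}{(N-1)!}\Big(\frac{d_2^\tau}{\eta\theta}\Big)^N\Big(\sum_{l=1}^{N-1}\frac1l-C+\ln\frac{(1-\theta)\rho\lambda_i}{\gamma_{th}d_1^\tau}\Big)-\Big(\frac{-\sigma_m}{1-\theta}\Big)^N\right]\Big(\frac{\gamma_{th}d_1^\tau}{\rho}\Big)^N,$$ where $C$ is the Euler–Mascheroni constant. Then the outage probability $P_I(\rho)=P\{\gamma_I<\gamma_{th}\}$ satisfies $\lim_{\rho\to\infty}P_I(\rho)/A(\rho)=1$. In particular $P_I(\rho)$ decays like $\rho^{-N}\ln\rho$ (diversity order $N$).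
   Context: Fix an integer $N\ge 1$ and constants $\eta\in(0,1]$, $\theta\in(0,1)$, $d_1,d_2>0$, $\tau>0$, $\gamma_{th}>0$; $\rho>0$ is the variable. Let $R_r,R_t$ be $N\times N$ Hermitian positive definite matrices with eigenvalues $\lambda_1,\dots,\lambda_N>0$ and $\sigma_1,\dots,\sigma_N>0$ respectively. Let $h_{w1}\in\mathbb C^{N\times1}$, $h_{w2}\in\mathbb C^{1\times N}$ be independent with i.i.d. zero-mean circularly symmetric complex Gaussian entries of unit variance, $h_1=R_r^{1/2}h_{w1}$, $h_2=h_{w2}R_t^{1/2}$, and $$\gamma_I=\frac{\frac{\eta\theta(1-\theta)\rho^2}{d_1^{2\tau}d_2^\tau}\|h_2\|^2\|h_1\|^4}{\frac{\eta\theta\rho}{d_1^\tau d_2^\tau}\|h_2\|^2\|h_1\|^2+\frac{(1-\theta)\rho}{d_1^\tau}\|h_1\|^2+1}.$$ Empty products and empty sums equal $1$ and $0$ respectively. *)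

(* Defs.v *)
From HB Require Import structures.
From mathcomp Require Import all_boot all_order all_algebra.
From mathcomp Require Import all_classical all_reals all_analysis.
From mathcomp Require Import complex.
Set Implicit Arguments. Unset Strict Implicit. Unset Printing Implicit Defensive.
Import Order.TTheory GRing.Theory Num.Theory.
Import numFieldNormedType.Exports.
Local Open Scope classical_set_scope.
Local Open Scope ring_scope.

Definition harmonic {R : realType} (n : nat) : R := \sum_(1 <= l < n.+1) (l%:R)^-1.
Definition euler_mascheroni {R : realType} : R :=
  lim ((fun n : nat => harmonic n - ln (n%:R : R)) @ \oo).

Definition ctrmx {R : realType} m n (A : 'M[R[i]]_(m, n)) : 'M[R[i]]_(n, m) :=
  map_mx (@conjc R) A^T.

Definition unitary_mx {R : realType} n (U : 'M[R[i]]_n) : Prop :=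
  U *m ctrmx U = 1%:M /\ ctrmx U *m U = 1%:M.

Definition eigendecomp {R : realType} n (Rm U : 'M[R[i]]_n) (lam : 'I_n -> R) : Prop :=
  unitary_mx U /\
  Rm = U *m diag_mx (\row_k ((lam k)%:C)%C) *m ctrmx U.

Definition sqrtm_of {R : realType} n (U : 'M[R[i]]_n) (lam : 'I_n -> R) : 'M[R[i]]_n :=
  U *m diag_mx (\row_k ((Num.sqrt (lam k))%:C)%C) *m ctrmx U.

Definition sqnorm {R : realType} m n (v : 'M[R[i]]_(m, n)) : R :=
  \sum_i \sum_j (complex.Re (v i j) ^+ 2 + complex.Im (v i j) ^+ 2).

(* mutual independence of a finite family of real random variables:
   the product rule for every choice of Borel sets (taking B i = setT
   recovers the product rule for every subfamily). *)
Definition mutually_independent {R : realType} d (T : measurableType d)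
    (P : probability T R) (I : finType) (X : I -> T -> R) : Prop :=
  forall B : I -> set R, (forall i, measurable (B i)) ->
    fine (P (\bigcap_(i in [set: I]) (X i @^-1` B i))) =
    \prod_(i : I) fine (P (X i @^-1` B i)).

Definition has_normal_law {R : realType} d (T : measurableType d)
    (P : probability T R) (X : T -> R) (m s : R) : Prop :=
  forall B : set R, measurable B -> P (X @^-1` B) = normal_prob m s B.

Definition coords {R : realType} d (T : measurableType d) (N : nat)
    (re1 im1 re2 im2 : 'I_N -> T -> R) : bool * bool * 'I_N -> T -> R :=
  fun p => match p with
           | (true, true, k) => re1 k | (true, false, k) => im1 k
           | (false, true, k) => re2 k | (false, false, k) => im2 k end.

(* h_w1, h_w2 have i.i.d. zero-mean circularly-symmetric complex Gaussian
   entries of unit variance: all real and imaginary parts are independent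
   N(0, 1/2). *)
Definition iid_CSCG_pair {R : realType} d (T : measurableType d)
    (P : probability T R) (N : nat) (re1 im1 re2 im2 : 'I_N -> T -> R) : Prop :=
  (forall p, measurable_fun setT (coords re1 im1 re2 im2 p)) /\
  mutually_independent P (coords re1 im1 re2 im2) /\
  (forall p, has_normal_law P (coords re1 im1 re2 im2 p) 0 (Num.sqrt (2^-1))).

Definition cvec_of {R : realType} d (T : measurableType d) N
    (re im : 'I_N -> T -> R) (w : T) : 'cV[R[i]]_N :=
  \col_k (Complex (re k w) (im k w)).
Definition rvec_of {R : realType} d (T : measurableType d) N
    (re im : 'I_N -> T -> R) (w : T) : 'rV[R[i]]_N :=
  \row_k (Complex (re k w) (im k w)).

(* the end-to-end SNR gamma_I, as a function of ||h_1||^2, ||h_2||^2 *)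
Definition gammaI {R : realType} (eta theta d1 d2 tau rho a1 a2 : R) : R :=
  (eta * theta * (1 - theta) * rho ^+ 2 / (d1 `^ (2 * tau) * d2 `^ tau) * a2 * a1 ^+ 2) /
  (eta * theta * rho / (d1 `^ tau * d2 `^ tau) * a2 * a1
   + (1 - theta) * rho / d1 `^ tau * a1 + 1).

Definition outage {R : realType} d (T : measurableType d) (P : probability T R) N
    (Rr_half Rt_half : 'M[R[i]]_N) (re1 im1 re2 im2 : 'I_N -> T -> R)
    (eta theta d1 d2 tau gth rho : R) : R :=
  fine (P [set w | gammaI eta theta d1 d2 tau rho
                     (sqnorm (Rr_half *m cvec_of re1 im1 w))
                     (sqnorm (rvec_of re2 im2 w *m Rt_half)) < gth]).

Definition A_asym {R : realType} N (lam sig : 'I_N -> R)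
    (eta theta d1 d2 tau gth rho : R) : R :=
  \sum_(i < N) \sum_(m < N)
    ((lam i)^-1 / \prod_(j < N | j != i) (lam i - lam j)) *
    ((sig m)^-1 / \prod_(n < N | n != m) (sig m - sig n)) *
    (N`!%:R)^-1 *
    ((((N.-1)`!%:R)^-1 * (d2 `^ tau / (eta * theta)) ^+ N *
        (harmonic N.-1 - euler_mascheroni
         + ln ((1 - theta) * rho * lam i / (gth * d1 `^ tau))))
     - (- sig m / (1 - theta)) ^+ N) *
    (gth * d1 `^ tau / rho) ^+ N.

(* Main.v *)
Require Import Defs.
From HB Require Import structures.
From mathcomp Require Import all_boot all_order all_algebra.
From mathcomp Require Import all_classical all_reals all_analysis.
From mathcomp Require Import complex ring lra measurable_realfun.
Set Implicit Arguments.
Unset Strict Implicit.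
Unset Printing Implicit Defensive.
Import Order.TTheory GRing.Theory Num.Theory.
Import numFieldNormedType.Exports.
Local Open Scope classical_set_scope.
Local Open Scope ring_scope.

(** Write [X = ||h_1||^2] and [Y = ||h_2||^2]. Then [gamma_I = p s / (p + s +
    1)], where [p] is [X Y] and [s] is [X], both times a constant and [rho].
    Outage contains [{p < gth}]; for every [E > 1], it is contained in [{s <
    S}] union [{p < E gth}] for some [S] independent of [rho]. The event [{s <
    S}] only contributes [O(rho^-N)], so the tail of [X Y] at [0] decides.

    The density of a complex Gaussian vector is nearly constant at the origin;
    integrating out one coordinate at a time, by Schur complements, [P (X < x)
    = a x^N (1 + O(x))] with [1 / a = N! det R_r], and likewise for [Y] with a
    constant [b]. Conditioning on [X], the probability of [X Y < t] is [b t^N]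
    times the expectation of [X^-N] over [X >= t], up to [O(t^N)]. By the
    layer-cake formula this expectation is the integral of [N s^(-N-1) P (X <
    s)] over [t < s < 1], namely [a N ln (1/t)], up to [O(1)].

    By Lagrange interpolation, [rho^N A(rho) = c ln rho + O(1)] with the same
    constant [c] as for the outage probability; the Euler-Mascheroni constant
    does not affect the limit. *)

(** * Independence *)

Section independence.
Context (R : realType) (d : measure_display) (T : measurableType d)
  (P : probability T R).

Definition independent_systems (G H : set (set T)) :=
  forall E F, G E -> H F -> P (E `&` F) = (P E * P F)%E.

Definition independent2 d1 d2 (U : measurableType d1) (V : measurableType d2)
    (X : T -> U) (Y : T -> V) :=
  forall A B, measurable A -> measurable B ->
    P (X @^-1` A `&` Y @^-1` B) = (P (X @^-1` A) * P (Y @^-1` B))%E.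

Lemma independent_systems_sym (G H : set (set T)) :
  independent_systems G H -> independent_systems H G.
Proof. by move=> GH E F HE GF; rewrite setIC muleC; exact: GH. Qed.

Lemma independent_systems_sigma_algebra_left (G H : set (set T)) :
  G `<=` measurable -> setI_closed G -> G setT -> H `<=` measurable ->
  independent_systems G H -> independent_systems <<s G>> H.
Proof.
move=> Gm GI GT Hm GH E F GE HF; have mF := Hm _ HF.
have PF : P F \is a fin_num by exact: fin_num_measure.
have PF0 : 0 <= fine (P F) by exact: fine_ge0.
transitivity (mscale (NngNum PF0) P E); last first.
  by rewrite /mscale/= fineK// muleC.
rewrite -[LHS]/(mrestr P mF E).
apply: (g_sigma_algebra_measure_unique G Gm (fun=> setT)) => //.
- by rewrite bigcup_const.
- by move=> A GA /=; rewrite /mrestr/mscale/= fineK// GH// muleC.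
- move=> k; rewrite /= /mrestr setTI.
  by rewrite (le_lt_trans (probability_le1 _ _))// ltry.
Qed.

Lemma independent_systems_sigma_algebra (G H : set (set T)) :
  G `<=` measurable -> setI_closed G -> G setT ->
  H `<=` measurable -> setI_closed H -> H setT ->
  independent_systems G H -> independent_systems <<s G>> <<s H>>.
Proof.
move=> Gm GI GT Hm HI HT GH.
have sGm := smallest_sub (@sigma_algebra_measurable _ T) Gm.
apply/independent_systems_sym/independent_systems_sigma_algebra_left => //.
exact/independent_systems_sym/independent_systems_sigma_algebra_left.
Qed.

Lemma independent2_joint_law d1 d2 (U : measurableType d1)
    (V : measurableType d2) (X : T -> U) (Y : T -> V)
    (m1 : probability U R) (m2 : probability V R) (E : set (U * V)) :
  measurable_fun setT X -> measurable_fun setT Y -> independent2 X Y ->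
  (forall A, measurable A -> P (X @^-1` A) = m1 A) ->
  (forall B, measurable B -> P (Y @^-1` B) = m2 B) ->
  measurable E -> P [set w | E (X w, Y w)] = (m1 \x m2)%E E.
Proof.
move=> mX mY indXY lawX lawY mE.
have mXY : measurable_fun setT (fun w => (X w, Y w)).
  exact: measurable_fun_pair.
pose PXY := distribution P (mfun_Sub (mem_set mXY)).
apply/esym; apply: (@product_measure_unique _ _ _ _ _ m1 m2 PXY) => //.
by move=> A B mA mB; have := indXY A B mA mB; rewrite lawX// lawY.
Qed.

Lemma probability_independent2 d1 d2 (U : measurableType d1)
    (V : measurableType d2) (X : T -> U) (Y : T -> V) (E : set (U * V)) :
  measurable_fun setT X -> measurable_fun setT Y -> independent2 X Y ->
  measurable E ->
  P [set w | E (X w, Y w)] = (\int[P]_w P (Y @^-1` xsection E (X w)))%E.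
Proof.
move=> mX mY indXY mE.
pose PX := distribution P (mfun_Sub (mem_set mX)).
pose PY := distribution P (mfun_Sub (mem_set mY)).
rewrite (independent2_joint_law (m1 := PX) (m2 := PY) mX mY indXY)//.
rewrite /product_measure1 /PX ge0_integral_distribution//=.
exact: (@measurable_fun_xsection _ _ _ _ _ PY).
Qed.

Lemma measurable_probability_xsection d1 d2 (U : measurableType d1)
    (V : measurableType d2) (X : T -> U) (Y : T -> V) (E : set (U * V)) :
  measurable_fun setT X -> measurable_fun setT Y -> measurable E ->
  measurable_fun setT (fun w => P (Y @^-1` xsection E (X w))).
Proof.
move=> mX mY mE.
pose PY := distribution P (mfun_Sub (mem_set mY)).
apply: (measurableT_comp (f := PY \o xsection E)) => //.
exact: (@measurable_fun_xsection _ _ _ _ _ PY).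
Qed.

End independence.

Section subfamilies.
Context (R : realType) (d : measure_display) (T : measurableType d)
  (P : probability T R) (I : finType) (X : I -> T -> R).

Definition cylinders (J : {set I}) : set (set T) :=
  [set E | exists2 B : I -> set R, (forall i, measurable (B i)) &
     E = \bigcap_(i in [set i | i \in J]) (X i @^-1` B i)].

Local Notation subfamily J := (g_sigma_algebraType (cylinders J)).

Hypothesis mX : forall i, measurable_fun setT (X i).
Hypothesis indX : mutually_independent P X.

Let measurable_preimage i (B : set R) :
  measurable B -> measurable (X i @^-1` B).
Proof. by move=> mB; rewrite -[X in measurable X]setTI; exact: mX. Qed.

Lemma cylinders_measurable J : cylinders J `<=` measurable.
Proof.
move=> _ [B mB ->]; apply: fin_bigcap_measurable => // i _.
exact: measurable_preimage.
Qed.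

Lemma setI_closed_cylinders J : setI_closed (cylinders J).
Proof.
move=> _ _ [A mA ->] [B mB ->]; exists (fun i => A i `&` B i).
  by move=> i; exact: measurableI.
by rewrite -bigcapI; apply: eq_bigcapr => i _; rewrite preimage_setI.
Qed.

Lemma cylinders_setT J : cylinders J setT.
Proof. by exists (fun=> setT) => //; apply/esym; rewrite -subTset. Qed.

Lemma probability_cylinder (J : {set I}) (B : I -> set R) :
  (forall i, measurable (B i)) ->
  P (\bigcap_(i in [set i | i \in J]) (X i @^-1` B i)) =
  (\prod_(i in J) fine (P (X i @^-1` B i)))%:E.
Proof.
move=> mB; pose D i := if i \in J then B i else setT.
have mD i : measurable (D i) by rewrite /D; case: ifP.
have -> : \bigcap_(i in [set i | i \in J]) (X i @^-1` B i) =
    \bigcap_(i in [set: I]) (X i @^-1` D i).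
  apply/seteqP; split => [w /= wJ i _ /=|w /= wJ i iJ].
    by rewrite /D; case: ifPn => // iJ; exact: wJ.
  by have := wJ i Logic.I; rewrite /= /D iJ.
rewrite -[LHS]fineK; last first.
  apply: fin_num_measure; apply: fin_bigcap_measurable => // i _.
  exact: measurable_preimage.
rewrite indX// (bigID (mem J))/= mulrC big1 ?mul1r => [|i /negbTE iJ].
  by congr EFin; apply: eq_bigr => i iJ; rewrite /D iJ.
by rewrite /D iJ preimage_setT probability_setT.
Qed.

Lemma independent_cylinders (J K : {set I}) : [disjoint J & K]%B ->
  independent_systems P (cylinders J) (cylinders K).
Proof.
move=> JK _ _ [A mA ->] [B mB ->]; rewrite !probability_cylinder//.
pose D i := if i \in J then A i else B i.
have mD i : measurable (D i) by rewrite /D; case: ifP.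
have DJ i : i \in J -> D i = A i by rewrite /D => ->.
have DK i : i \in K -> D i = B i.
  by rewrite /D; case: ifPn => // /(disjointFr JK) ->.
rewrite (_ : _ `&` _ =
    \bigcap_(i in [set i | i \in J :|: K]) (X i @^-1` D i)).
  rewrite probability_cylinder// -EFinM; congr EFin.
  rewrite (eq_bigl [predU J & K])/= => [|i]; last by rewrite !inE.
  rewrite bigU/=; last exact: JK.
  by congr *%R; apply: eq_bigr => i iJK; [rewrite DJ|rewrite DK].
apply/seteqP; split => [w [/= wJ wK] i /=|w /= wJ].
  rewrite inE => /orP[iJ|iK]; first by rewrite DJ//; exact: wJ.
  by rewrite DK//; exact: wK.
split=> i /= iJ; have /= := wJ i; rewrite inE iJ ?orbT => /(_ isT).
  by rewrite DJ.
by rewrite DK.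
Qed.

Lemma independent2_subfamilies (J K : {set I}) d1 d2 (U : measurableType d1)
    (V : measurableType d2) (f : T -> U) (g : T -> V) : [disjoint J & K]%B ->
  measurable_fun setT (f : subfamily J -> U) ->
  measurable_fun setT (g : subfamily K -> V) ->
  independent2 P f g.
Proof.
move=> JK mf mg A B mA mB.
have ind := independent_systems_sigma_algebra
  (@cylinders_measurable J) (@setI_closed_cylinders J) (@cylinders_setT J)
  (@cylinders_measurable K) (@setI_closed_cylinders K) (@cylinders_setT K)
  (independent_cylinders JK).
apply: ind; first by have := mf measurableT A mA; rewrite setTI.
by have := mg measurableT B mB; rewrite setTI.
Qed.

Lemma measurable_fun_subfamily (J : {set I}) d1 (U : measurableType d1)
    (f : T -> U) :
  measurable_fun setT (f : subfamily J -> U) -> measurable_fun setT f.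
Proof.
move=> mf _ A mA; apply: (smallest_sub (@sigma_algebra_measurable _ T)
  (@cylinders_measurable J)); exact: mf.
Qed.

Lemma measurable_subfamily (J : {set I}) i : i \in J ->
  measurable_fun setT (X i : subfamily J -> R).
Proof.
move=> iJ _ B mB; rewrite setTI; apply: sub_sigma_algebra.
exists (fun j => if j == i then B else setT); first by move=> j; case: ifP.
apply/seteqP; split => [w /= wB j /= _|w /= /(_ i iJ)/=]; last by rewrite eqxx.
by case: eqP => // ->.
Qed.

End subfamilies.

Notation subfamily X J := (g_sigma_algebraType (cylinders X J)).

(** * Complex random variables *)

Section squared_modulus.
Context (R : realType).
Implicit Types x y z : R[i].

Definition sqnormc z : R := complex.Re z ^+ 2 + complex.Im z ^+ 2.

Lemma sqnormc_ge0 z : 0 <= sqnormc z.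
Proof. by rewrite addr_ge0 ?sqr_ge0. Qed.

Lemma sqnormc0 : sqnormc 0 = 0.
Proof. by rewrite /sqnormc/= expr0n addr0. Qed.

Lemma sqnormc_eq0 z : (sqnormc z == 0) = (z == 0).
Proof.
by rewrite eq_complex paddr_eq0 ?sqr_ge0// !sqrf_eq0.
Qed.

Lemma sqnormcM x y : sqnormc (x * y) = sqnormc x * sqnormc y.
Proof. by case: x y => a b [a' b']; rewrite /sqnormc /=; ring. Qed.

Lemma conjc_mul_self z : z^* * z = ((sqnormc z)%:C)%C.
Proof. by case: z => a b; rewrite /sqnormc; simpc; congr Complex; ring. Qed.

Lemma ReD x y : complex.Re (x + y) = complex.Re x + complex.Re y.
Proof. by case: x y => ? ? []. Qed.

Lemma ImD x y : complex.Im (x + y) = complex.Im x + complex.Im y.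
Proof. by case: x y => ? ? []. Qed.

Lemma ReM x y : complex.Re (x * y) =
  complex.Re x * complex.Re y - complex.Im x * complex.Im y.
Proof. by case: x y => ? ? []. Qed.

Lemma ImM x y : complex.Im (x * y) =
  complex.Re x * complex.Im y + complex.Im x * complex.Re y.
Proof. by case: x y => ? ? []. Qed.

Lemma Re_conjc z : complex.Re (conjc z) = complex.Re z.
Proof. by case: z. Qed.

Lemma Im_conjc z : complex.Im (conjc z) = - complex.Im z.
Proof. by case: z. Qed.

End squared_modulus.

Section complex_measurability.
Context (R : realType) (d : measure_display) (T : measurableType d).
Implicit Types f g : T -> R[i].

Lemma measurable_lt (u v : T -> R) :
  measurable_fun setT u -> measurable_fun setT v ->
  measurable [set w | u w < v w].
Proof.
move=> mu mv; rewrite -[X in measurable X]setTI.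
exact: (measurable_fun_ltr mu mv measurableT (Y := [set true])).
Qed.

Definition cmeasurable f :=
  measurable_fun setT (fun w => complex.Re (f w)) /\
  measurable_fun setT (fun w => complex.Im (f w)).

Lemma cmeasurable_cst (c : R[i]) : cmeasurable (fun=> c).
Proof. by split. Qed.

Lemma cmeasurableD f g : cmeasurable f -> cmeasurable g ->
  cmeasurable (fun w => f w + g w).
Proof.
move=> [mRf mIf] [mRg mIg]; split.
  by under eq_fun do rewrite ReD; exact: measurable_funD.
by under eq_fun do rewrite ImD; exact: measurable_funD.
Qed.

Lemma cmeasurableM f g : cmeasurable f -> cmeasurable g ->
  cmeasurable (fun w => f w * g w).
Proof.
move=> [mRf mIf] [mRg mIg]; split.
  under eq_fun do rewrite ReM.
  by apply: measurable_funB; exact: measurable_funM.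
under eq_fun do rewrite ImM.
by apply: measurable_funD; exact: measurable_funM.
Qed.

Lemma cmeasurableN f : cmeasurable f -> cmeasurable (fun w => - f w).
Proof.
move=> mf; under eq_fun do rewrite -mulN1r.
exact: cmeasurableM (cmeasurable_cst _) mf.
Qed.

Lemma cmeasurable_conjc f : cmeasurable f -> cmeasurable (fun w => conjc (f w)).
Proof.
move=> [mRf mIf]; split; first by under eq_fun do rewrite Re_conjc.
by under eq_fun do rewrite Im_conjc; exact: measurableT_comp.
Qed.

Lemma cmeasurable_sum (I : Type) (s : seq I) (f : I -> T -> R[i]) :
  (forall i, cmeasurable (f i)) -> cmeasurable (fun w => \sum_(i <- s) f i w).
Proof.
move=> mf; elim: s => [|i s IH].
  by under eq_fun do rewrite big_nil; exact: cmeasurable_cst.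
by under eq_fun do rewrite big_cons; exact: cmeasurableD.
Qed.

Lemma measurable_sqnormc f : cmeasurable f ->
  measurable_fun setT (fun w => sqnormc (f w)).
Proof. by move=> [mRf mIf]; apply: measurable_funD; apply: measurable_funX. Qed.

End complex_measurability.

Lemma cmeasurable_comp (R : realType) d d' (T : measurableType d)
    (U : measurableType d') (f : U -> R[i]) (g : T -> U) :
  cmeasurable f -> measurable_fun setT g -> cmeasurable (f \o g).
Proof.
by move=> [mRf mIf] mg; split; [apply: measurableT_comp mRf mg|
  apply: measurableT_comp mIf mg].
Qed.

(** * Gaussian measure of a disc *)

Section fundamental_theorem.
Context (R : realType).
Local Notation mu := (@lebesgue_measure R).

Lemma is_derive_continuous (F : R -> R) (x df : R) :
  is_derive x (1 : R) F df -> {for x, continuous F}.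
Proof. by case=> dF _; exact/differentiable_continuous/derivable1_diffP. Qed.

Lemma is_derive_LRcontinuous (F f : R -> R) (a b : R) : a < b ->
  {in `[a, b], forall x, is_derive x (1 : R) F (f x)} ->
  derivable_oo_LRcontinuous F a b.
Proof.
move=> ab dF; split.
- by move=> x xab; case: (dF x) => //; exact: subset_itv_oo_cc.
- apply: cvg_at_right_filter; apply: is_derive_continuous (dF a _).
  by rewrite in_itv/= lexx ltW.
- apply: cvg_at_left_filter; apply: is_derive_continuous (dF b _).
  by rewrite in_itv/= lexx ltW.
Qed.

Lemma integral_is_derive (F f : R -> R) (a b : R) : a < b ->
  {in `[a, b], forall x, is_derive x (1 : R) F (f x)} ->
  {within `[a, b], continuous f} ->
  (\int[mu]_(x in `[a, b]) (f x)%:E = (F b - F a)%:E)%E.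
Proof.
move=> ab dF cf; rewrite (@continuous_FTC2 _ f F)// ?EFinB//.
  exact: is_derive_LRcontinuous ab dF.
by move=> x /subset_itv_oo_cc/dF dFx; rewrite derive1E derive_val.
Qed.

Lemma within_continuous_measurable_obnd (f : R -> R) (a b : R) :
  {within `[a, b], continuous f} -> measurable_fun `]a, b] f.
Proof.
move=> cf; apply: (measurable_funS (E := `[a, b]%classic)) => //.
  exact: subset_itv_oc_cc.
exact: subspace_continuous_measurable_fun.
Qed.

Lemma integral_is_derive_obnd (F f : R -> R) (a b : R) : a < b ->
  {in `[a, b], forall x, is_derive x (1 : R) F (f x)} ->
  {within `[a, b], continuous f} ->
  (\int[mu]_(x in `]a, b]) (f x)%:E = (F b - F a)%:E)%E.
Proof.
move=> ab dF cf; rewrite integral_itv_obnd_cbnd; last first.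
  by apply/measurable_EFinP; exact: within_continuous_measurable_obnd.
exact: integral_is_derive.
Qed.

Lemma is_derive_exprn (n : nat) (x : R) :
  is_derive x (1 : R) (fun y => y ^+ n) (n%:R * x ^+ n.-1).
Proof.
split; first exact: exprn_derivable.
by rewrite exp_derive /GRing.scale/= mulr1.
Qed.

Lemma is_derive_expVn (n : nat) (x : R) : x != 0 ->
  is_derive x (1 : R) (fun y => y ^- n) (- (n%:R * x ^- n.+1)).
Proof.
move=> x0; have dX := is_derive_exprn n x.
have dV := @is_deriveV _ (fun y => y ^+ n) _ _ _ (expf_neq0 n x0) dX.
apply: is_derive_eq; rewrite /GRing.scale/=.
case: n {dX dV} => [|n]; first by rewrite !mul0r mulr0 oppr0.
by rewrite /= !exprS; field; rewrite expf_neq0.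
Qed.

End fundamental_theorem.

Section disc.
Context (R : realType).
Local Notation mu := (@lebesgue_measure R).

Definition disc (c : R[i]) (t : R) : set (R * R) :=
  [set z | sqnormc ((z.1 +i* z.2)%C - c) < t].

Lemma discE c t z :
  disc c t z =
  ((z.1 - complex.Re c) ^+ 2 + (z.2 - complex.Im c) ^+ 2 < t) :> Prop.
Proof. by rewrite /disc/=; case: c. Qed.

Lemma disc_eq0 c t : t <= 0 -> disc c t = set0.
Proof.
move=> t0; rewrite -subset0 => z; rewrite /disc/= => /lt_le_trans/(_ t0).
by rewrite ltNge sqnormc_ge0.
Qed.

Lemma measurable_disc c t : measurable (disc c t).
Proof.
apply: measurable_lt => //; apply: measurable_sqnormc.
apply: cmeasurableD; last exact: cmeasurable_cst.
by split; [exact: measurable_fst|exact: measurable_snd].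
Qed.

Definition half_chord (c t u : R) : R := Num.sqrt (t - (u - c) ^+ 2).

Lemma continuous_half_chord c t : continuous (half_chord c t).
Proof.
move=> x; apply: (cvg_comp _ (@Num.sqrt R)); last exact: sqrt_continuous.
apply: cvgB; first exact: cvg_cst.
apply: (cvg_comp (fun x => x - c) (fun x => x ^+ 2));
  last exact: sqr_continuous.
by apply: cvgB; [exact: cvg_id|exact: cvg_cst].
Qed.

Lemma ltr_norm_sqrt (x y : R) : (`|x| < Num.sqrt y) = (x ^+ 2 < y).
Proof.
have [y0|y0] := ltP 0 y; first by rewrite -sqrtr_sqr ltr_sqrt.
rewrite ler0_sqrtr// [LHS]ltNge normr_ge0; apply/esym/negbTE.
by rewrite -leNgt (le_trans y0) ?sqr_ge0.
Qed.

Lemma xsection_disc c t u : xsection (disc c t) u =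
  `](complex.Im c - half_chord (complex.Re c) t u),
    (complex.Im c + half_chord (complex.Re c) t u)[%classic.
Proof.
apply/seteqP; split => v; rewrite /xsection/= inE discE/= in_itv/=;
  by rewrite -ltr_distl ltr_norm_sqrt ltrBrDl.
Qed.

Lemma integral_cos_sqr (t : R) :
  (\int[mu]_(x in `[(- (pi / 2))%R, (pi / 2)%R]) (t * cos x ^+ 2)%:E)%E =
  (pi * t / 2)%:E.
Proof.
have pi0 := pi_gt0 R.
rewrite (@integral_is_derive _ (fun x => t / 2 * (x + sin x * cos x))).
- by rewrite sinN cosN cos_pihalf !mulr0; congr EFin; field.
- by lra.
- move=> x _; apply: is_derive_eq; rewrite /GRing.scale /=.
  by rewrite -[X in X + _](cos2Dsin2 x); field.
- apply: continuous_subspaceT => x; apply: cvgM; first exact: cvg_cst.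
  apply: (cvg_comp _ (fun x => x ^+ 2)); last exact: sqr_continuous.
  exact: continuous_cos.
Qed.

(* By the substitution [u = c + sqrt t * sin x]. *)
Lemma integral_half_chord_itv (c t : R) : 0 < t ->
  (\int[mu]_(u in `[(c - Num.sqrt t)%R, (c + Num.sqrt t)%R])
     (half_chord c t u)%:E)%E = (pi * t / 2)%:E.
Proof.
move=> t0; set s := Num.sqrt t.
have s0 : 0 < s by rewrite sqrtr_gt0.
have s2 : s ^+ 2 = t by rewrite sqr_sqrtr// ltW.
have pi0 := pi_gt0 R.
pose F (x : R) : R := c + s * sin x.
have dF x : is_derive x (1 : R) F (s * cos x).
  by apply: is_derive_eq; rewrite add0r mul1r.
have F'E : derive1 F = (fun x => s * cos x).
  by apply/funext => x; rewrite derive1E derive_val.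
have cF' : continuous (fun x : R => s * cos x).
  by move=> x; apply: cvgM; [exact: cvg_cst|exact: continuous_cos].
have -> : c - s = F (- (pi / 2)) by rewrite /F sinN sin_pihalf mulrN1.
have -> : c + s = F (pi / 2) by rewrite /F sin_pihalf mulr1.
rewrite integration_by_substitution_increasing; last 7 first.
- by lra.
- by move=> x y xI yI xy; rewrite /F ltrD2l ltr_pM2l// ltr_sin.
- by move=> x _; rewrite F'E.
- by rewrite F'E; apply/cvg_ex; eexists; apply: cvg_at_right_filter; exact: cF'.
- by rewrite F'E; apply/cvg_ex; eexists; apply: cvg_at_left_filter; exact: cF'.
- by apply: (is_derive_LRcontinuous (f := fun x => s * cos x)); [lra|].
- by apply: continuous_subspaceT; exact: continuous_half_chord.
rewrite -integral_cos_sqr; apply: eq_integral => x;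
  rewrite inE/= in_itv/= => xI.
transitivity (half_chord c t (F x) * (s * cos x))%:E; first by rewrite F'E.
congr EFin; rewrite /half_chord /F [c + _]addrC addrK exprMn s2.
have -> : t - t * sin x ^+ 2 = t * cos x ^+ 2 by rewrite cos2sin2; ring.
rewrite sqrtrM ?ltW// -/s sqrtr_sqr ger0_norm; last exact: cos_ge0_pihalf.
by rewrite mulrACA -expr2 s2 -expr2.
Qed.

Lemma integral_half_chord (c t : R) : 0 < t ->
  (\int[mu]_u (half_chord c t u)%:E)%E = (pi * t / 2)%:E.
Proof.
move=> t0; rewrite -(integral_half_chord_itv c t0) [RHS]integral_mkcond.
apply: eq_integral => u _; rewrite patchE; case: ifPn => //.
rewrite notin_setE/= in_itv/= => /negP uI; congr EFin; apply: ler0_sqrtr.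
rewrite subr_le0 leNgt; apply: contra uI; rewrite -ltr_norm_sqrt ltr_distl.
by case/andP => ? ?; apply/andP; split; exact: ltW.
Qed.

Lemma disc_area c t :
  (mu \x mu)%E (disc c t) = (pi * Num.max t 0)%:E.
Proof.
have [t0|t0] := leP t 0; first by rewrite disc_eq0// measure0 mulr0.
transitivity (\int[mu]_u (2%:E * (half_chord (complex.Re c) t u)%:E))%E.
  apply: eq_integral => u _; rewrite /= xsection_disc lebesgue_measure_itv/=.
  rewrite lte_fin; set s := half_chord _ _ _.
  have := sqrtr_ge0 (t - (u - complex.Re c) ^+ 2); rewrite -/(half_chord _ _ _).
  rewrite -/s le_eqVlt => /predU1P[<-|s0].
    by rewrite subr0 addr0 ltxx mule0.
  by rewrite ifT ?ltrD2l ?gtrN// -EFinB -EFinM; congr EFin; ring.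
rewrite ge0_integralZl//; last 2 first.
- apply/measurable_EFinP; apply: continuous_measurable_fun.
  exact: continuous_half_chord.
- by move=> u _; rewrite lee_fin sqrtr_ge0.
by rewrite integral_half_chord// -EFinM; congr EFin; field.
Qed.

End disc.

Section standard_complex_gaussian.
Context (R : realType).
Local Notation mu := (@lebesgue_measure R).
Local Notation nu := (normal_prob (0 : R) (Num.sqrt 2^-1)).

Lemma ge0_integral_normal_prob (m s : R) (f : R -> \bar R) :
  measurable_fun setT f -> (forall x, 0 <= f x)%E ->
  (\int[normal_prob m s]_x f x = \int[mu]_x (f x * (normal_pdf m s x)%:E))%E.
Proof.
move=> mf f0; have dom := @normal_prob_dominates R m s.
rewrite -(Radon_Nikodym_SigmaFinite.change_of_variables dom)//.
have mpdf : measurable_fun setT (fun x => (normal_pdf m s x)%:E).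
  by apply/measurable_EFinP; exact: measurable_normal_pdf.
have intRN := Radon_Nikodym_SigmaFinite.f_integrable dom.
apply: ae_eq_integral => //.
- by apply: emeasurable_funM => //; exact: measurable_int intRN.
- exact: emeasurable_funM.
- apply: ae_eqe_mul2l; apply: integral_ae_eq => // E _ mE.
  by rewrite -Radon_Nikodym_SigmaFinite.f_integral.
Qed.

Definition cgauss_pdf (z : R * R) : R := pi^-1 * expR (- (z.1 ^+ 2 + z.2 ^+ 2)).

Lemma cgauss_pdf_ge0 z : 0 <= cgauss_pdf z.
Proof. by rewrite mulr_ge0 ?expR_ge0// invr_ge0 pi_ge0. Qed.

Lemma measurable_cgauss_pdf : measurable_fun setT cgauss_pdf.
Proof.
apply: measurable_funM => //; apply: measurableT_comp => //.
apply: measurableT_comp => //.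
by apply: measurable_funD; apply: measurable_funX.
Qed.

Lemma normal_pdfM (u v : R) :
  normal_pdf 0 (Num.sqrt 2^-1) u * normal_pdf 0 (Num.sqrt 2^-1) v =
  cgauss_pdf (u, v).
Proof.
have pdfE (x : R) :
    normal_pdf 0 (Num.sqrt 2^-1) x = (Num.sqrt pi)^-1 * expR (- x ^+ 2).
  rewrite normal_pdfE; last by rewrite sqrtr_eq0 -ltNge.
  rewrite /normal_peak /normal_fun sqr_sqrtr// subr0 -[_ *+ 2]mulr_natr.
  rewrite -[X in expR (_ / X)]mulr_natr mulVf// divr1.
  by congr (_ * _); congr ((Num.sqrt _)^-1); field.
rewrite !pdfE mulrACA -expRD -opprD -invfM -expr2 sqr_sqrtr ?pi_ge0//.
Qed.

Lemma cgauss_density (E : set (R * R)) : measurable E ->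
  ((nu \x nu) E = \int[mu \x mu]_(z in E) (cgauss_pdf z)%:E)%E.
Proof.
move=> mE; rewrite [RHS]integral_mkcond fubini_tonelli1; last 2 first.
- apply/(measurable_restrictT _ mE)/measurable_EFinP/measurable_funTS.
  exact: measurable_cgauss_pdf.
- by apply: erestrict_ge0 => z _; rewrite lee_fin cgauss_pdf_ge0.
rewrite [LHS]ge0_integral_normal_prob//; last first.
  exact: measurable_fun_xsection.
apply: eq_integral => u _; rewrite /fubini_F.
rewrite [LHS]muleC -ge0_integralZl//=; last 4 first.
- exact: measurable_xsection.
- apply/measurable_EFinP/measurable_funTS; exact: measurable_normal_pdf.
- by move=> v _; rewrite lee_fin normal_pdf_ge0.
- by rewrite lee_fin normal_pdf_ge0.
rewrite integral_mkcond; apply: eq_integral => v _.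
by rewrite !patchE mem_xsection -EFinM normal_pdfM.
Qed.

Lemma cgauss_disc_le (c : R[i]) (t : R) :
  ((nu \x nu) (disc c t) <= (Num.max t 0)%:E)%E.
Proof.
have piV0 : 0 <= (pi : R)^-1 by rewrite invr_ge0 pi_ge0.
have mD := measurable_disc c t.
rewrite cgauss_density//.
apply: (@le_trans _ _ (\int[mu \x mu]_(z in disc c t) (pi^-1)%:E)%E).
  apply: ge0_le_integral => //=.
  - by move=> z _; rewrite lee_fin cgauss_pdf_ge0.
  - apply/measurable_EFinP/measurable_funTS; exact: measurable_cgauss_pdf.
  - move=> z _; rewrite lee_fin ler_piMr// -expR0 ler_expR oppr_le0.
    by rewrite addr_ge0 ?sqr_ge0.
rewrite integral_cst//= disc_area -EFinM mulrA mulVf ?mul1r//.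
by rewrite gt_eqF ?pi_gt0.
Qed.

Lemma cgauss_disc_ge (c : R[i]) (t r : R) :
  (forall z, disc c t z -> z.1 ^+ 2 + z.2 ^+ 2 <= r) ->
  ((expR (- r) * Num.max t 0)%:E <= (nu \x nu) (disc c t))%E.
Proof.
move=> zr; have mD := measurable_disc c t.
have piV0 : 0 <= (pi : R)^-1 by rewrite invr_ge0 pi_ge0.
rewrite cgauss_density// (_ : expR (- r) * _ =
    pi^-1 * expR (- r) * (pi * Num.max t 0)); last first.
  by rewrite mulrACA mulVf ?mul1r// gt_eqF ?pi_gt0.
rewrite EFinM -(disc_area c) -integral_cst//; apply: ge0_le_integral => //=.
- by move=> z _; rewrite lee_fin mulr_ge0 ?expR_ge0.
- apply/measurable_EFinP/measurable_funTS; exact: measurable_cgauss_pdf.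
- by move=> z /zr zr'; rewrite lee_fin ler_wpM2l// ler_expR lerN2.
Qed.

End standard_complex_gaussian.

(** * Hermitian positive definite forms *)

Section complex_matrices.
Context (R : realType).
Local Notation C := R[i].

Lemma sqnormcD_le (x y : C) (a b c d : R) :
  0 <= a -> 0 <= b -> 0 <= c -> 0 <= d ->
  sqnormc x <= a * b -> sqnormc y <= c * d ->
  sqnormc (x + y) <= (a + c) * (b + d).
Proof.
case: x y => [x1 x2] [y1 y2]; rewrite /sqnormc /= => a0 b0 c0 d0 xab ycd.
have adbc0 : 0 <= a * d + b * c by rewrite addr_ge0 ?mulr_ge0.
have inner_sqr : (2 * (x1 * y1 + x2 * y2)) ^+ 2 <= (a * d + b * c) ^+ 2.
  have := ler_pM (addr_ge0 (sqr_ge0 _) (sqr_ge0 _))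
    (addr_ge0 (sqr_ge0 _) (sqr_ge0 _)) xab ycd.
  have := sqr_ge0 (x1 * y2 - x2 * y1); have := sqr_ge0 (a * d - b * c); lra.
have inner : 2 * (x1 * y1 + x2 * y2) <= a * d + b * c.
  have [/le_trans->//|/ltW ?] := leP (2 * (x1 * y1 + x2 * y2)) 0.
  by rewrite -ler_sqr.
lra.
Qed.

Lemma sqnormc_sumM_le (I : Type) (s : seq I) (x y : I -> C) :
  sqnormc (\sum_(i <- s) x i * y i) <=
  (\sum_(i <- s) sqnormc (x i)) * (\sum_(i <- s) sqnormc (y i)).
Proof.
elim: s => [|i s IH]; first by rewrite !big_nil sqnormc0 mul0r.
by rewrite !big_cons sqnormcD_le ?sqnormcM ?sqnormc_ge0 ?sumr_ge0//;
  move=> *; exact: sqnormc_ge0.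
Qed.

Lemma sqnormE m n (A : 'M[C]_(m, n)) : sqnorm A = \sum_i \sum_j sqnormc (A i j).
Proof. by []. Qed.

Lemma sqnorm_ge0 m n (A : 'M[C]_(m, n)) : 0 <= sqnorm A.
Proof. by do 2 apply: sumr_ge0 => ? _; exact: sqnormc_ge0. Qed.

Lemma sqnorm_eq0 m n (A : 'M[C]_(m, n)) : (sqnorm A == 0) = (A == 0).
Proof.
have row_ge0 i : 0 <= \sum_j sqnormc (A i j).
  by apply: sumr_ge0 => j _; exact: sqnormc_ge0.
apply/idP/eqP => [|->]; last first.
  by rewrite sqnormE big1// => i _; rewrite big1// => j _; rewrite mxE sqnormc0.
rewrite sqnormE psumr_eq0 => [/allP A0|//]; apply/matrixP => i j.
have := A0 i; rewrite mem_index_enum => /(_ isT).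
rewrite psumr_eq0 => [/allP/(_ j)|k _]; last exact: sqnormc_ge0.
by rewrite mem_index_enum => /(_ isT); rewrite sqnormc_eq0 mxE => /eqP.
Qed.

Lemma sqnorm_tr m n (A : 'M[C]_(m, n)) : sqnorm A^T = sqnorm A.
Proof.
rewrite !sqnormE exchange_big; apply: eq_bigr => i _.
by apply: eq_bigr => j _; rewrite mxE.
Qed.

Lemma sqnorm_col_mx m n (z : 'cV[C]_m) (h : 'cV[C]_n) :
  sqnorm (col_mx z h) = sqnorm z + sqnorm h.
Proof.
rewrite !sqnormE big_split_ord; congr (_ + _); apply: eq_bigr => i _;
  by apply: eq_bigr => j _; rewrite ?col_mxEu ?col_mxEd.
Qed.

Lemma sqnorm_mulmx_le m n p (A : 'M[C]_(m, n)) (B : 'M[C]_(n, p)) :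
  sqnorm (A *m B) <= sqnorm A * sqnorm B.
Proof.
rewrite -[sqnorm B]sqnorm_tr !sqnormE mulr_suml; apply: ler_sum => i _.
rewrite mulr_sumr; apply: ler_sum => j _; rewrite mxE.
apply: le_trans (sqnormc_sumM_le _ _ _) _; rewrite ler_wpM2l//.
  by apply: sumr_ge0 => k _; exact: sqnormc_ge0.
by apply: ler_sum => k _; rewrite mxE.
Qed.

Lemma ctrmxM m n p (A : 'M[C]_(m, n)) (B : 'M[C]_(n, p)) :
  ctrmx (A *m B) = ctrmx B *m ctrmx A.
Proof. by rewrite /ctrmx trmx_mul map_mxM. Qed.

Lemma ctrmxK m n (A : 'M[C]_(m, n)) : ctrmx (ctrmx A) = A.
Proof. by apply/matrixP => i j; rewrite !mxE conjcK. Qed.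

Lemma ctrmxZ m n (a : R) (A : 'M[C]_(m, n)) :
  ctrmx ((a%:C)%C *: A) = (a%:C)%C *: ctrmx A.
Proof. by apply/matrixP => i j; rewrite !mxE rmorphM/= oppr0. Qed.

Lemma sqnorm_ctrmxM n (v : 'cV[C]_n) :
  sqnorm v = complex.Re ((ctrmx v *m v) ord0 ord0).
Proof.
rewrite sqnormE mxE; under eq_bigr do rewrite big_ord1.
elim/big_ind2: _ => // [x x' y y' -> ->|i _]; first by rewrite ReD.
by rewrite !mxE conjc_mul_self.
Qed.

End complex_matrices.

Section quadratic_form.
Context (R : realType).
Local Notation C := R[i].

Definition qf n (M : 'M[C]_n) (h : 'cV[C]_n) : R :=
  complex.Re ((ctrmx h *m M *m h) ord0 ord0).

Definition posdefmx n (M : 'M[C]_n) : Prop :=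
  ctrmx M = M /\ forall h, h != 0 -> 0 < qf M h.

Lemma qf0 n (M : 'M[C]_n) : qf M 0 = 0.
Proof. by rewrite /qf mulmx0 mxE. Qed.

Lemma qf_ge0 n (M : 'M[C]_n) h : posdefmx M -> 0 <= qf M h.
Proof.
by move=> [_ M0]; have [->|/M0/ltW//] := eqVneq h 0; rewrite qf0.
Qed.

Lemma sqnorm_mulmx m n (A : 'M[C]_(m, n)) (h : 'cV[C]_n) :
  sqnorm (A *m h) = qf (ctrmx A *m A) h.
Proof. by rewrite sqnorm_ctrmxM /qf ctrmxM !mulmxA. Qed.

Lemma qf_delta n (M : 'M[C]_n) i : qf M (delta_mx i ord0) = complex.Re (M i i).
Proof.
rewrite /qf (_ : ctrmx _ = delta_mx ord0 i); first by rewrite -rowE -colE !mxE.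
by rewrite /ctrmx trmx_delta map_delta_mx.
Qed.

Lemma qf_congruence m n (D : 'M[C]_m) (A : 'M[C]_(m, n)) h :
  qf (ctrmx A *m D *m A) h = qf D (A *m h).
Proof. by rewrite /qf ctrmxM !mulmxA. Qed.

Lemma qf_block_diag n (a : R) (D : 'M[C]_n) (z : 'cV[C]_1) (h : 'cV[C]_n) :
  qf (block_mx (a%:C)%C%:M 0 0 D) (col_mx z h) = a * sqnorm z + qf D h.
Proof.
rewrite /qf {1}/ctrmx tr_col_mx map_row_mx mul_row_block !mulmx0 addr0 add0r.
rewrite mul_row_col mxE ReD; congr (_ + _).
rewrite mul_mx_scalar -scalemxAl mxE -/(ctrmx z) sqnorm_ctrmxM.
by case: ((ctrmx z *m z) _ _) => x y /=; rewrite mul0r subr0.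
Qed.

Section schur_complement.
Variables (n : nat) (M : 'M[C]_(1 + n)).

Definition pivot : R := complex.Re (M ord0 ord0).
Definition pivot_row : 'rV[C]_n := (pivot^-1)%:C%C *: ursubmx M.
Definition elim_mx : 'M[C]_(1 + n) := block_mx 1%:M pivot_row 0 1%:M.
Definition schur : 'M[C]_n := drsubmx M - ctrmx (ursubmx M) *m pivot_row.

Lemma elim_mx_col (z : C) (h : 'cV[C]_n) :
  elim_mx *m col_mx z%:M h = col_mx (z + (pivot_row *m h) ord0 ord0)%:M h.
Proof.
rewrite mul_block_col !mul1mx mul0mx add0r; congr col_mx.
by rewrite [pivot_row *m h]mx11_scalar -raddfD/= !mxE mulr1n.
Qed.

Hypothesis Mp : posdefmx M.

Lemma pivot_gt0 : 0 < pivot.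
Proof.
rewrite /pivot -qf_delta; apply: Mp.2; apply/eqP => /matrixP/(_ ord0 ord0)/eqP.
by rewrite !mxE !eqxx oner_eq0.
Qed.

Lemma posdefmx_block : M = block_mx pivot%:C%C%:M (ursubmx M)
  (ctrmx (ursubmx M)) (drsubmx M).
Proof.
rewrite -[LHS]submxK; congr block_mx.
  rewrite [LHS]mx11_scalar; congr (_%:M); rewrite !mxE /pivot.
  rewrite (_ : lshift n ord0 = ord0); last exact: val_inj.
  have /matrixP/(_ ord0 ord0) := Mp.1; rewrite !mxE.
  by case: (M _ _) => x y /= [] yy; congr Complex; lra.
by rewrite -{1}Mp.1; apply/matrixP => i j; rewrite !mxE.
Qed.

Lemma schur_factorization :
  M = ctrmx elim_mx *m block_mx pivot%:C%C%:M 0 0 schur *m elim_mx.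
Proof.
have pivotV : (pivot%:C * (pivot^-1)%:C)%C = 1 :> C.
  by rewrite -rmorphM mulfV// gt_eqF// pivot_gt0.
have pivotM : pivot%:C%C%:M *m pivot_row = ursubmx M.
  by rewrite mul_scalar_mx scalerA pivotV scale1r.
have ctrmxMpivot : ctrmx pivot_row *m pivot%:C%C%:M = ctrmx (ursubmx M).
  rewrite ctrmxZ mul_mx_scalar scalerA pivotV scale1r//.
rewrite {1}posdefmx_block /elim_mx /ctrmx tr_block_mx map_block_mx.
rewrite !trmx1 !trmx0 !map_mx1 !map_mx0 -!/(ctrmx _).
rewrite !mulmx_block !mul1mx !mul0mx !mulmx0 !mulmx1 !addr0 !add0r.
by rewrite pivotM ctrmxMpivot /schur addrC subrK.
Qed.

Lemma qf_schur (v : 'cV[C]_(1 + n)) :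
  qf M v = qf (block_mx pivot%:C%C%:M 0 0 schur) (elim_mx *m v).
Proof. by rewrite {1}schur_factorization qf_congruence. Qed.

Lemma det_schur : \det M = (pivot%:C)%C * \det schur.
Proof.
rewrite schur_factorization !det_mulmx /elim_mx /ctrmx tr_block_mx map_block_mx.
rewrite !trmx1 !trmx0 !map_mx1 !map_mx0 !det_lblock !det_ublock.
rewrite !det1 det_scalar1.
by rewrite !mulr1 !mul1r.
Qed.

Lemma qf_schurE (z : C) (h : 'cV[C]_n) : qf M (col_mx z%:M h) =
  pivot * sqnormc (z + (pivot_row *m h) ord0 ord0) + qf schur h.
Proof.
rewrite qf_schur elim_mx_col qf_block_diag; congr (_ * _ + _).
by rewrite sqnormE !big_ord1 mxE mulr1n.
Qed.

Lemma posdefmx_schur : posdefmx schur.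
Proof.
split.
  rewrite /schur /pivot_row -scalemxAr /ctrmx raddfB map_mxB -!/(ctrmx _).
  rewrite ctrmxZ ctrmxM ctrmxK; congr (_ - _).
  by rewrite -[in RHS]Mp.1; apply/matrixP => i j; rewrite !mxE.
move=> h h0; pose z := - (pivot_row *m h) ord0 ord0.
have := Mp.2 (col_mx z%:M h); rewrite qf_schurE addNr sqnormc0.
rewrite mulr0 add0r; apply; apply: contra h0 => /eqP.
by rewrite -col_mx0 => /eq_col_mx[_ ->].
Qed.

End schur_complement.

Lemma posdefmx_coercive n (M : 'M[C]_n) : posdefmx M -> exists2 K : R, 0 <= K &
  forall h, sqnorm h <= K * qf M h.
Proof.
elim: n M => [|n IH] M Mp.
  by exists 0 => // h; rewrite sqnormE big_ord0 mul0r.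
have a0 := pivot_gt0 Mp; have M'p := posdefmx_schur Mp.
have [K K0 hK] := IH _ M'p.
pose V : 'M[C]_(1 + n) := block_mx 1%:M (- pivot_row M) 0 1%:M.
have VE : V *m elim_mx M = 1%:M.
  rewrite mulmx_block !mul1mx !mul0mx !mulmx0 !mulmx1 !addr0 !add0r subrr.
  by rewrite [RHS]scalar_mx_block.
exists (sqnorm V * ((pivot M)^-1 + K)).
  by rewrite mulr_ge0 ?sqnorm_ge0// addr_ge0 ?invr_ge0// ltW.
move=> h; rewrite qf_schur// -[h in sqnorm h]mul1mx -VE -mulmxA.
set v := elim_mx M *m h.
apply: le_trans (sqnorm_mulmx_le _ _) _; rewrite -mulrA ler_wpM2l ?sqnorm_ge0//.
rewrite -[v]vsubmxK qf_block_diag sqnorm_col_mx.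
set z := usubmx v; set h' := dsubmx v.
rewrite mulrDl; apply: lerD.
  rewrite mulrDr mulrA mulVf ?gt_eqF// mul1r lerDl mulr_ge0 ?qf_ge0//.
  by rewrite invr_ge0 ltW.
apply: le_trans (hK h') _; rewrite ler_wpM2l// lerDr mulr_ge0 ?sqnorm_ge0//.
exact: ltW.
Qed.

Lemma posdefmx_pivot_coercive n (M : 'M[C]_(1 + n)) : posdefmx M ->
  exists2 K : R, 0 <= K & forall (z : C) (h : 'cV[C]_n), sqnormc z <=
    K * (pivot M * sqnormc (z + (pivot_row M *m h) ord0 ord0) + qf (schur M) h).
Proof.
move=> Mp; have [K K0 coercive] := posdefmx_coercive Mp; exists K => // z h.
rewrite -qf_schurE//; apply: le_trans (coercive _); rewrite sqnorm_col_mx.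
by rewrite sqnormE !big_ord1 mxE mulr1n lerDl sqnorm_ge0.
Qed.

End quadratic_form.

Section eigendecomposition.
Context (R : realType) (n : nat).

Definition unitary_diag (V : 'M[R[i]]_n) (f : 'I_n -> R) : 'M[R[i]]_n :=
  V *m diag_mx (\row_k ((f k)%:C)%C) *m ctrmx V.

Lemma ctrmx_unitary_diag V f : ctrmx (unitary_diag V f) = unitary_diag V f.
Proof.
rewrite /unitary_diag !ctrmxM ctrmxK mulmxA; congr (_ *m _ *m _).
apply/matrixP => i j; rewrite !mxE eq_sym; case: eqP => [->|_].
  by rewrite !mulr1n conjc_real.
by rewrite !mulr0n conjc0.
Qed.

Lemma tr_unitary_diag V f :
  (unitary_diag V f)^T = unitary_diag (map_mx (@conjc R) V) f.
Proof.
rewrite /unitary_diag !trmx_mul tr_diag_mx mulmxA /ctrmx map_trmx trmxK.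
by congr (_ *m _); apply/matrixP => i j; rewrite !mxE conjcK.
Qed.

Lemma sqrtm_ofE (V : 'M[R[i]]_n) f :
  sqrtm_of V f = unitary_diag V (fun k => Num.sqrt (f k)).
Proof. by []. Qed.

Variables (M U : 'M[R[i]]_n) (lam : 'I_n -> R).
Hypothesis eigM : eigendecomp M U lam.

Lemma eigendecompE : M = unitary_diag U lam.
Proof. by case: eigM. Qed.

Lemma det_eigendecomp : \det M = ((\prod_k lam k)%:C)%C.
Proof.
have [[_ UU] _] := eigM.
rewrite eigendecompE !det_mulmx mulrC mulrA -det_mulmx UU det1 mul1r det_diag.
by rewrite rmorph_prod; apply: eq_bigr => k _; rewrite mxE.
Qed.

Lemma eigendecomp_tr : eigendecomp M^T (map_mx (@conjc R) U) lam.
Proof.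
have [[UU1 UU2] _] := eigM; split; last by rewrite eigendecompE tr_unitary_diag.
have ctrmx_conj : ctrmx (map_mx (@conjc R) U) = map_mx (@conjc R) (ctrmx U).
  by rewrite /ctrmx map_trmx.
by rewrite /unitary_mx ctrmx_conj -!map_mxM UU1 UU2 map_mx1.
Qed.

Hypothesis lam0 : forall k, 0 < lam k.

Lemma sqrtm_of_sqr : sqrtm_of U lam *m sqrtm_of U lam = M.
Proof.
have [[_ UU] ->] := eigM; rewrite /sqrtm_of -!mulmxA.
rewrite (mulmxA (ctrmx U)) UU mul1mx.
congr (_ *m _); rewrite !mulmxA mulmx_diag; congr (diag_mx _ *m _).
by apply/rowP => k; rewrite !mxE -rmorphM/= -expr2 sqr_sqrtr// ltW.
Qed.

Lemma sqnorm_sqrtm_of (h : 'cV[R[i]]_n) : sqnorm (sqrtm_of U lam *m h) = qf M h.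
Proof.
by rewrite sqnorm_mulmx sqrtm_ofE ctrmx_unitary_diag -sqrtm_ofE sqrtm_of_sqr.
Qed.

Lemma posdefmx_eigendecomp : posdefmx M.
Proof.
split; first by rewrite eigendecompE ctrmx_unitary_diag.
move=> h h0; rewrite -sqnorm_sqrtm_of lt_def sqnorm_ge0 andbT sqnorm_eq0.
apply: contra h0 => /eqP Sh0; apply/eqP.
have unitM : M \in unitmx.
  rewrite unitmxE det_eigendecomp unitfE (inj_eq (@complexI _)).
  by apply/prodf_neq0 => k _; rewrite gt_eqF.
apply: (can_inj (mulKmx unitM)).
by rewrite mulmx0 -sqrtm_of_sqr -mulmxA Sh0 mulmx0.
Qed.

End eigendecomposition.

Lemma sqnorm_mulmx_sqrtm_of (R : realType) m n (v : 'M[R[i]]_(m, n))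
    (U : 'M[R[i]]_n) (lam : 'I_n -> R) :
  sqnorm (v *m sqrtm_of U lam) =
  sqnorm (sqrtm_of (map_mx (@conjc R) U) lam *m v^T).
Proof. by rewrite -sqnorm_tr trmx_mul !sqrtm_ofE tr_unitary_diag. Qed.

Section quadratic_form_measurability.
Context (R : realType) (d : measure_display) (T : measurableType d).
Local Notation C := R[i].
Variables (n : nat) (h : T -> 'cV[C]_n).
Hypothesis mh : forall k, cmeasurable (fun w => h w k ord0).

Lemma cmeasurable_mulmx (l : 'rV[C]_n) :
  cmeasurable (fun w => (l *m h w) ord0 ord0).
Proof.
under eq_fun do rewrite mxE.
by apply: cmeasurable_sum => i; apply: cmeasurableM => //;
  exact: cmeasurable_cst.
Qed.

Lemma measurable_qf (M : 'M[C]_n) : measurable_fun setT (fun w => qf M (h w)).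
Proof.
suff [] : cmeasurable (fun w => (ctrmx (h w) *m M *m h w) ord0 ord0) by [].
under eq_fun do rewrite mxE.
apply: cmeasurable_sum => i; apply: cmeasurableM => //.
under eq_fun do rewrite mxE.
apply: cmeasurable_sum => j; apply: cmeasurableM; last exact: cmeasurable_cst.
by under eq_fun do rewrite !mxE; exact: cmeasurable_conjc.
Qed.

End quadratic_form_measurability.

(** * Layer-cake formulas *)

Section layer_cake.
Context (R : realType) (d : measure_display) (T : measurableType d)
  (P : probability T R).
Local Notation mu := (@lebesgue_measure R).

Lemma layer_cake (q : T -> R) (f : R -> R) (a b : R) :
  measurable_fun setT q -> measurable_fun `]a, b] f ->
  (forall s, s \in `]a, b] -> 0 <= f s) ->
  (\int[P]_w \int[mu]_(s in `]Num.max a (q w), b]) (f s)%:E =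
   \int[mu]_(s in `]a, b]) ((f s)%:E * P [set w | (q w < s)%R]))%E.
Proof.
move=> mq mf f0.
pose A : set (T * measurableTypeR R) := [set z | q z.1 < z.2].
have mA : measurable A.
  apply: measurable_lt => //; exact: measurableT_comp mq measurable_fst.
pose g : R -> \bar R := (EFin \o f) \_ `]a, b].
have mg : measurable_fun setT g.
  exact/(measurable_restrictT _ (measurable_itv _))/measurable_EFinP.
have g0 s : (0 <= g s)%E.
  by apply: erestrict_ge0 => ?; rewrite lee_fin; exact: f0.
transitivity (\int[P]_w \int[mu]_s (g s * (\1_A (w, s))%:E))%E.
  apply: eq_integral => w _; rewrite integral_mkcond; apply: eq_integral => s _.
  rewrite /g !patchE indicE (_ : ((w, s) \in A) = (q w < s)); last first.
    by apply/idP/idP; rewrite inE.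
  rewrite !mem_setE !in_itv/= gt_max.
  by case: (q w < s); case: (a < s); case: (s <= b); rewrite /= ?mule1 ?mule0.
rewrite (@fubini_tonelli _ _ _ _ _ P mu
  (fun z => g z.2 * (\1_A z)%:E)%E); last 2 first.
- apply: emeasurable_funM; first exact: measurableT_comp mg measurable_snd.
  by apply/measurable_EFinP; exact: measurable_indic.
- by move=> z; rewrite mule_ge0.
rewrite [RHS]integral_mkcond; apply: eq_integral => s _ /=.
have mqs : measurable [set w | q w < s] by exact: measurable_lt.
rewrite (_ : (fun w => g s * (\1_A (w, s))%:E) =
    (fun w => g s * (\1_[set w | q w < s] w)%:E))%E; last first.
  by apply/funext => w; rewrite !indicE; congr (_ * (_%:R)%:E)%E;
    apply/idP/idP; rewrite !inE.
rewrite ge0_integralZl//; last first.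
  by apply/measurable_EFinP; exact: measurable_indic.
rewrite integral_indic// setIT /g !patchE.
by case: ifP => //; rewrite mul0e.
Qed.

Lemma measurable_cdf_lt (q : T -> R) : measurable_fun setT q ->
  measurable_fun setT (fun s : R => P [set w | (q w < s)%R]).
Proof.
move=> mq; have mqs (s : R) : measurable [set w | q w < s].
  exact: measurable_lt.
rewrite (_ : (fun _ => _) = (fun s => (fine (P [set w | (q w < s)%R]))%:E)).
  apply/measurable_EFinP; apply: nondecreasing_measurable => // s t st.
  rewrite fine_le ?fin_num_measure//; apply: le_measure; rewrite ?inE//.
  by move=> w /= /lt_le_trans; apply.
by apply/funext => s; rewrite fineK// fin_num_measure.
Qed.

Lemma integral_positive_part (q : T -> R) (x : R) :
  measurable_fun setT q -> (forall w, 0 <= q w) ->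
  (\int[P]_w (Num.max (x - q w) 0)%R%:E =
   \int[mu]_(s in `]0%R, x]) P [set w | (q w < s)%R])%E.
Proof.
move=> mq q0; transitivity
  (\int[mu]_(s in `]0%R, x]) (1%:E * P [set w | (q w < s)%R]))%E; last first.
  by apply: eq_integral => s _; rewrite mul1e.
rewrite -layer_cake//; apply: eq_integral => w _.
rewrite integral_cst//= mul1e lebesgue_measure_itv/= lte_fin.
rewrite (max_idPr (q0 w)) EFin_max EFinB; case: ltP => qx.
  by apply/max_idPl; rewrite -EFinB lee_fin subr_ge0 ltW.
by apply/max_idPr; rewrite -EFinB lee_fin subr_le0.
Qed.

End layer_cake.

(** * Small-ball probabilities of Gaussian quadratic forms *)

Section small_ball_law.
Context (R : realType) (d : measure_display) (T : measurableType d)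
  (P : probability T R).
Local Notation mu := (@lebesgue_measure R).
Local Notation nu := (normal_prob (0 : R) (Num.sqrt 2^-1)).

(* [P [V < x] = c * x ^ n * (1 + O(x))], the upper bound holding for all [x]. *)
Definition small_ball_law (V : T -> R) (c : R) (n : nat) : Prop :=
  exists2 K : R, 0 <= K & forall x, 0 < x ->
    ((c * expR (- (K * x)) * x ^+ n)%:E <= P [set w | (V w < x)%R]
       <= (c * x ^+ n)%:E)%E.

Lemma small_ball_law_ge0 V c n : small_ball_law V c n -> 0 <= c.
Proof.
move=> [K _ /(_ 1 ltr01)/andP[_]]; rewrite expr1n mulr1 => PV1.
by have := le_trans (measure_ge0 _ _) PV1; rewrite lee_fin.
Qed.

Lemma integral_expn (c x : R) (n : nat) : 0 < x ->
  (\int[mu]_(s in `]0%R, x]) (c * s ^+ n)%:E)%E = (c / n.+1%:R * x ^+ n.+1)%:E.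
Proof.
move=> x0; rewrite integral_itv_obnd_cbnd; last first.
  by apply/measurable_EFinP; apply: measurable_funM.
rewrite (@integral_is_derive _ (fun s => c / n.+1%:R * s ^+ n.+1))//.
- by rewrite expr0n/= mulr0 subr0.
- move=> s _; have dX := is_derive_exprn n.+1 s.
  apply: is_derive_eq; rewrite /GRing.scale/=.
  by field; rewrite addrC natr1 pnatr_eq0.
- apply: continuous_subspaceT => s; apply: cvgM; first exact: cvg_cst.
  exact: exprn_continuous.
Qed.

Lemma positive_part_small_ball_law (q : T -> R) (c : R) (n : nat) :
  measurable_fun setT q -> (forall w, 0 <= q w) -> small_ball_law q c n ->
  exists2 K : R, 0 <= K & forall x, 0 < x ->
    ((c / n.+1%:R * expR (- (K * x)) * x ^+ n.+1)%:E <=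
       \int[P]_w (Num.max (x - q w) 0)%R%:E <= (c / n.+1%:R * x ^+ n.+1)%:E)%E.
Proof.
move=> mq q0 qlaw; have c0 := small_ball_law_ge0 qlaw.
have [K K0 Pq] := qlaw; exists K => // x x0; rewrite integral_positive_part//.
have mF : measurable_fun `]0, x] (fun s : R => P [set w | (q w < s)%R]).
  by apply: measurable_funTS; exact: measurable_cdf_lt.
apply/andP; split.
  rewrite [c / _ * _]mulrAC -integral_expn//; apply: ge0_le_integral => //=.
  - move=> s; rewrite in_itv/= => /andP[/ltW s0 _].
    by rewrite lee_fin !mulr_ge0 ?exprn_ge0 ?expR_ge0.
  - by apply/measurable_EFinP; apply: measurable_funM.
  - move=> s; rewrite in_itv/= => /andP[s0 sx]; have /andP[+ _] := Pq s s0.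
    apply: le_trans; rewrite lee_fin ler_wpM2r ?exprn_ge0 ?(ltW s0)//.
    by rewrite ler_wpM2l// ler_expR lerN2 ler_wpM2l.
rewrite -integral_expn//; apply: ge0_le_integral => //=.
- by apply/measurable_EFinP; apply: measurable_funM.
- by move=> s; rewrite in_itv/= => /andP[s0 _]; have /andP[] := Pq s s0.
Qed.

(* A positive definite form in a complex Gaussian vector, conditioned on all
   coordinates but the first, is [a * |z - c|^2 + q] for Gaussian [z]. *)
Lemma small_ball_law_mixture (V q : T -> R) (c : T -> R[i]) (a C k : R)
    (n : nat) :
  0 < a -> measurable_fun setT q -> (forall w, 0 <= q w) -> 0 <= C ->
  (forall w (z : R * R), z.1 ^+ 2 + z.2 ^+ 2 <=
     C * (a * sqnormc ((z.1 +i* z.2)%C - c w) + q w)) ->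
  (forall x, measurable_fun setT
     (fun w => (nu \x nu)%E (disc (c w) ((x - q w) / a)))) ->
  (forall x, P [set w | (V w < x)%R] =
     \int[P]_w (nu \x nu) (disc (c w) ((x - q w) / a)))%E ->
  small_ball_law q k n -> small_ball_law V (k / n.+1%:R / a) n.+1.
Proof.
move=> a0 mq q0 C0 coercive mdisc PV qlaw.
have [K K0 Eq] := positive_part_small_ball_law mq q0 qlaw.
exists (C + K) => [|x x0]; first exact: addr_ge0.
have a0V : 0 <= a^-1 by rewrite invr_ge0 ltW.
have mpos : measurable_fun setT (fun w => (Num.max (x - q w) 0)%:E).
  by apply/measurable_EFinP; apply: measurable_maxr => //;
    exact: measurable_funB.
have pos0 w : (0 <= (Num.max (x - q w) 0)%:E)%E
  by rewrite lee_fin le_max lexx orbT.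
have maxVa w : Num.max ((x - q w) / a) 0 = a^-1 * Num.max (x - q w) 0.
  by rewrite maxr_pMr// mulr0 mulrC.
have /andP[lo hi] := Eq x x0; rewrite PV; apply/andP; split.
  have -> : (k / n.+1%:R / a * expR (- ((C + K) * x)) * x ^+ n.+1)%:E =
      ((expR (- (C * x)) / a)%:E *
        (k / n.+1%:R * expR (- (K * x)) * x ^+ n.+1)%:E)%E.
    by rewrite -EFinM mulrDl opprD expRD; congr EFin; ring.
  have e0 : 0 <= expR (- (C * x)) / a by rewrite divr_ge0 ?expR_ge0// ltW.
  apply: le_trans (lee_wpmul2l _ lo) _; rewrite ?lee_fin//.
  rewrite -ge0_integralZl//; apply: ge0_le_integral => //=.
  - by move=> w _; rewrite mule_ge0.
  - exact: emeasurable_funM.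
  - move=> w _; rewrite -EFinM -mulrA -maxVa; apply: cgauss_disc_ge => z.
    rewrite /disc/= ltr_pdivlMr// => zx; apply: le_trans (coercive w z) _.
    by rewrite ler_wpM2l//; lra.
have -> : (k / n.+1%:R / a * x ^+ n.+1)%:E =
    (a^-1%:E * (k / n.+1%:R * x ^+ n.+1)%:E)%E.
  by rewrite -EFinM; congr EFin; ring.
apply: le_trans (lee_wpmul2l _ hi); rewrite ?lee_fin//.
rewrite -ge0_integralZl//; apply: ge0_le_integral => //=.
- exact: emeasurable_funM.
- by move=> w _; rewrite -EFinM -maxVa cgauss_disc_le.
Qed.

End small_ball_law.

Section conditioning.
Context (R : realType) (d d' : measure_display) (T : measurableType d)
  (T' : measurableType d') (P : probability T R).
Local Notation nu := (normal_prob (0 : R) (Num.sqrt 2^-1)).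
Variables (Z1 Z2 : T -> R) (S : T -> T') (c : T' -> R[i]) (q : T' -> R) (a : R).
Hypotheses (mZ1 : measurable_fun setT Z1) (mZ2 : measurable_fun setT Z2).
Hypotheses (mS : measurable_fun setT S) (mc : cmeasurable c).
Hypothesis mq : measurable_fun setT q.
Hypotheses (lawZ1 : has_normal_law P Z1 0 (Num.sqrt 2^-1))
  (lawZ2 : has_normal_law P Z2 0 (Num.sqrt 2^-1)).
Hypotheses (indZ : independent2 P Z1 Z2)
  (indS : independent2 P S (fun w => (Z1 w, Z2 w))).
Hypothesis a0 : 0 < a.

Let event (x : R) : set (T' * (R * R)) :=
  [set z | a * sqnormc ((z.2.1 +i* z.2.2)%C - c z.1) + q z.1 < x].

Let mZ : measurable_fun setT (fun w => (Z1 w, Z2 w)).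
Proof. exact: measurable_fun_pair. Qed.

Let measurable_event x : measurable (event x).
Proof.
have mc1 := cmeasurable_comp mc (@measurable_fst _ _ T' (R * R)%type).
have mz : cmeasurable (fun z : T' * (R * R) => (z.2.1 +i* z.2.2)%C).
  split; first exact: measurableT_comp measurable_fst measurable_snd.
  exact: measurableT_comp measurable_snd measurable_snd.
apply: measurable_lt => //; apply: measurable_funD.
  apply: measurable_funM => //; apply: measurable_sqnormc.
  exact: cmeasurableD mz (cmeasurableN mc1).
exact: measurableT_comp mq measurable_fst.
Qed.

Let probability_pair (D : set (R * R)) : measurable D ->
  P ((fun w => (Z1 w, Z2 w)) @^-1` D) = (nu \x nu)%E D.
Proof.
exact: (independent2_joint_law (m1 := nu) (m2 := nu) mZ1 mZ2 indZ lawZ1 lawZ2).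
Qed.

Let probability_xsection_event x w :
  P ((fun w => (Z1 w, Z2 w)) @^-1` xsection (event x) (S w)) =
  (nu \x nu)%E (disc (c (S w)) ((x - q (S w)) / a)).
Proof.
rewrite -probability_pair; last exact: measurable_disc.
congr (P (_ @^-1` _)); apply/seteqP; split => z;
  by rewrite /xsection /event /disc /= inE/= ltr_pdivlMr// ltrBrDr [_ * a]mulrC.
Qed.

Let probability_gaussian_shift x :
  P [set w | a * sqnormc ((Z1 w +i* Z2 w)%C - c (S w)) + q (S w) < x] =
  (\int[P]_w (nu \x nu) (disc (c (S w)) ((x - q (S w)) / a)))%E.
Proof.
rewrite -[LHS]/(P [set w | event x (S w, (Z1 w, Z2 w))]).
rewrite (probability_independent2 mS mZ indS)//.
by apply: eq_integral => w _; exact: probability_xsection_event.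
Qed.

Let measurable_gaussian_shift x : measurable_fun setT
  (fun w => (nu \x nu)%E (disc (c (S w)) ((x - q (S w)) / a))).
Proof.
have := measurable_probability_xsection P mS mZ (measurable_event x).
by apply: eq_measurable_fun => w _; exact: probability_xsection_event.
Qed.

Lemma small_ball_law_gaussian_shift (C k : R) (n : nat) :
  (forall s, 0 <= q s) -> 0 <= C ->
  (forall z s, sqnormc z <= C * (a * sqnormc (z - c s) + q s)) ->
  small_ball_law P (q \o S) k n ->
  small_ball_law P
    (fun w => a * sqnormc ((Z1 w +i* Z2 w)%C - c (S w)) + q (S w))
    (k / n.+1%:R / a) n.+1.
Proof.
move=> q0 C0 coercive; apply: (small_ball_law_mixture (c := c \o S)) C0 _
  measurable_gaussian_shift probability_gaussian_shift => //.
  exact: measurableT_comp.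
by move=> w z; exact: (coercive (z.1 +i* z.2)%C).
Qed.

End conditioning.

Section gaussian_vector.
Context (R : realType) (d : measure_display) (T : measurableType d)
  (P : probability T R) (I : finType) (X : I -> T -> R).

(* [iota (true, k)] and [iota (false, k)] index the real and the imaginary part
   of the [k]-th coordinate. *)
Definition gvec n (iota : bool * 'I_n -> I) (w : T) : 'cV[R[i]]_n :=
  cvec_of (fun k => X (iota (true, k))) (fun k => X (iota (false, k))) w.

Lemma gvecS n (iota : bool * 'I_n.+1 -> I) w : gvec iota w =
  col_mx (X (iota (true, ord0)) w +i* X (iota (false, ord0)) w)%C%:M
    (gvec (fun p => iota (p.1, lift ord0 p.2)) w).
Proof.
apply/(@matrixP _ (1 + n) 1) => i j; rewrite [j]ord1 [LHS]mxE.
case: (@split_ordP 1 n i) => k ->.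
  rewrite [k]ord1 col_mxEu mxE mulr1n (_ : lshift n ord0 = ord0)//.
  exact: val_inj.
by rewrite col_mxEd mxE (_ : lift ord0 k = rshift 1 k)//; exact: val_inj.
Qed.

Lemma cmeasurable_gvec n (iota : bool * 'I_n -> I) (J : {set I}) k :
  (forall p, iota p \in J) ->
  cmeasurable (fun w : subfamily X J => gvec iota w k ord0).
Proof.
by move=> iJ; split; under eq_fun do rewrite mxE /=;
  exact: measurable_subfamily.
Qed.

Hypothesis mX : forall i, measurable_fun setT (X i).
Hypothesis indX : mutually_independent P X.
Hypothesis lawX : forall i, has_normal_law P (X i) 0 (Num.sqrt 2^-1).

Lemma independent2_coords (i j : I) : i != j -> independent2 P (X i) (X j).
Proof.
move=> ij; apply: (independent2_subfamilies mX indX (J := [set i]%SET)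
  (K := [set j]%SET)); last 2 first.
- by apply: measurable_subfamily; rewrite inE.
- by apply: measurable_subfamily; rewrite inE.
by rewrite disjoints1 inE.
Qed.

Lemma independent2_subfamily_pair (J : {set I}) (i j : I) :
  i \notin J -> j \notin J ->
  independent2 P (id : T -> subfamily X J) (fun w => (X i w, X j w)).
Proof.
move=> iJ jJ; apply: (independent2_subfamilies mX indX (J := J)
  (K := [set i; j]%SET)) => //.
  rewrite disjoint_sym disjoint_subset; apply/fintype.subsetP => k.
  by rewrite !inE => /orP[]/eqP->.
by apply: measurable_fun_pair; apply: measurable_subfamily;
  rewrite !inE eqxx ?orbT.
Qed.

Lemma small_ball_law_qf_dim0 (M : 'M[R[i]]_0) (iota : bool * 'I_0 -> I) :
  small_ball_law P (fun w => qf M (gvec iota w))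
    (0`!%:R * complex.Re (\det M))^-1 0.
Proof.
exists 0 => // x x0; rewrite det_mx00 fact0 /= mul0r oppr0 expR0 !mulr1 invr1.
rewrite (_ : [set w | _] = setT) ?probability_setT ?lexx//.
rewrite -subTset => w _ /=; rewrite (_ : gvec iota w = 0) ?qf0//.
by apply/matrixP => -[].
Qed.

(* Induction on [n]: the Schur complement isolates the first coordinate. *)
Lemma small_ball_law_qf n (M : 'M[R[i]]_n) (iota : bool * 'I_n -> I) :
  posdefmx M -> injective iota ->
  small_ball_law P (fun w => qf M (gvec iota w))
    (n`!%:R * complex.Re (\det M))^-1 n.
Proof.
elim: n M iota => [|n IH] M iota Mp iota_inj.
  exact: small_ball_law_qf_dim0.
pose iota' p := iota (p.1, lift ord0 p.2).
have iota'_inj : injective iota'.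
  move=> [b k] [b' k'] /iota_inj/eqP; rewrite xpair_eqE (inj_eq lift_inj)/=.
  by case/andP => /eqP-> /eqP->.
pose J' := [set iota' p | p : bool * 'I_n]%SET.
have headJ' b : iota (b, ord0) \notin J'.
  apply/imsetP => -[[b' k] _ /iota_inj/eqP].
  by rewrite xpair_eqE (negbTE (neq_lift _ _)) andbF.
pose c (w : subfamily X J') :=
  - (pivot_row (n := n) M *m gvec iota' w) ord0 ord0.
pose q (w : subfamily X J') := qf (schur (n := n) M) (gvec iota' w).
have mgvec k : cmeasurable (fun w : subfamily X J' => gvec iota' w k ord0).
  by apply: cmeasurable_gvec => p; apply/imsetP; exists p.
have mq : measurable_fun setT q by exact: measurable_qf.
have mc : cmeasurable c by apply: cmeasurableN; exact: cmeasurable_mulmx.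
have mid : measurable_fun setT (id : T -> subfamily X J').
  exact: (measurable_fun_subfamily mX (@measurable_id _ _ setT)).
have ind : independent2 P (X (iota (true, ord0))) (X (iota (false, ord0))).
  by apply: independent2_coords; rewrite (inj_eq iota_inj).
have indS := independent2_subfamily_pair (headJ' true) (headJ' false).
have [C C0 coercive] := posdefmx_pivot_coercive Mp.
have -> : (n.+1`!%:R * complex.Re (\det M))^-1 =
    (n`!%:R * complex.Re (\det (schur (n := n) M)))^-1 / n.+1%:R /
    pivot (n := n) M.
  rewrite det_schur// factS natrM.
  by case: (\det _) => x y /=; rewrite mul0r subr0 !invfM; ring.
rewrite (_ : (fun w => _) = (fun w => pivot (n := n) M * sqnormc
    ((X (iota (true, ord0)) w +i* X (iota (false, ord0)) w)%C - c w) + q w)).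
  apply: (small_ball_law_gaussian_shift (mX _) (mX _) mid mc mq
    (lawX _) (lawX _) ind indS (pivot_gt0 Mp) _ C0).
  - by move=> w; apply: qf_ge0; exact: posdefmx_schur.
  - by move=> z w; rewrite opprK; exact: coercive.
  - exact: IH (posdefmx_schur Mp) iota'_inj.
by apply/funext => w; rewrite gvecS qf_schurE// opprK.
Qed.

End gaussian_vector.

(** * Product of two independent variables near zero *)

Section negative_powers.
Context (R : realType).
Local Notation mu := (@lebesgue_measure R).

Lemma within_continuous_expVn (c : R) (n : nat) (a b : R) : 0 < a ->
  {within `[a, b], continuous (fun s => c * s ^- n)}.
Proof.
move=> a0; apply: derivable_within_continuous => s.
rewrite in_itv/= => /andP[as_ _]; apply: derivableM => //.
by have [] := is_derive_expVn n (lt0r_neq0 (lt_le_trans a0 as_)).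
Qed.

Lemma measurable_expVn (c : R) (n : nat) (a b : R) : 0 < a ->
  measurable_fun `]a, b] (fun s => c * s ^- n).
Proof.
move=> a0; apply: within_continuous_measurable_obnd.
exact: within_continuous_expVn.
Qed.

Lemma integral_expVn (n : nat) (a b : R) : 0 < a -> a < b ->
  (\int[mu]_(s in `]a, b]) (n%:R * s ^- n.+1)%:E = (a ^- n - b ^- n)%:E)%E.
Proof.
move=> a0 ab; rewrite (@integral_is_derive_obnd _ (fun s => - s ^- n))//.
- by rewrite opprK addrC.
- move=> s; rewrite in_itv/= => /andP[as_ _].
  have dV := is_derive_expVn n (lt0r_neq0 (lt_le_trans a0 as_)).
  by apply: is_derive_eq; rewrite opprK.
- exact: within_continuous_expVn.
Qed.

Lemma integral_inv (c a b : R) : 0 < a -> a < b ->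
  (\int[mu]_(s in `]a, b]) (c * s^-1)%:E = (c * (ln b - ln a))%:E)%E.
Proof.
move=> a0 ab; rewrite (@integral_is_derive_obnd _ (fun s => c * ln s))//.
- by rewrite mulrBr.
- move=> s; rewrite in_itv/= => /andP[as_ _].
  have dln := is_derive1_ln (lt_le_trans a0 as_).
  by apply: is_derive_eq.
- exact: (@within_continuous_expVn c 1).
Qed.

End negative_powers.

Section truncated_inverse_moments.
Context (R : realType) (d : measure_display) (T : measurableType d)
  (P : probability T R) (X : T -> R).
Hypothesis mX : measurable_fun setT X.
Local Notation mu := (@lebesgue_measure R).

(* [1 + invpow_excess n t x] is [y ^- n] for [y] the projection of [x] on
   [t, 1]. *)
Definition invpow_excess (n : nat) (t x : R) : R :=
  Num.max (Num.max t x ^- n - 1) 0.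

Lemma invpow_excess_ge0 n t x : 0 <= invpow_excess n t x.
Proof. by rewrite le_max lexx orbT. Qed.

Lemma invpow_excess_le n t x : 0 < t -> invpow_excess n t x <= Num.max t x ^- n.
Proof.
move=> t0; rewrite ge_max lerBlDr lerDl ler01/= invr_ge0 exprn_ge0//.
by rewrite le_max ltW.
Qed.

Lemma invpow_le_excess n t x : t <= x -> x ^- n <= 1 + invpow_excess n t x.
Proof.
by move=> tx; rewrite -lerBlDl /invpow_excess (max_idPr tx) le_max lexx.
Qed.

Lemma nonincreasing_invpow_excess (n : nat) (t : R) : 0 < t ->
  nonincreasing_fun (invpow_excess n t).
Proof.
move=> t0 x y xy; have max0 z : 0 < Num.max t z by rewrite lt_max t0.
have max_le : Num.max t x <= Num.max t y by rewrite ge_max !le_max lexx xy orbT.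
rewrite /invpow_excess ge_max !le_max lexx orbT andbT lerD2r.
by rewrite lef_pV2 ?posrE ?exprn_gt0// lerXn2r// nnegrE ltW.
Qed.

Lemma measurable_invpow_excess (n : nat) (t : R) : 0 < t ->
  measurable_fun setT (fun w => invpow_excess n t (X w)).
Proof.
move=> t0; apply: (measurableT_comp (f := invpow_excess n t)) => //.
by apply: nonincreasing_measurable => //; exact: nonincreasing_invpow_excess.
Qed.

Lemma integral_expVn_invpow_excess (n : nat) (t x : R) : 0 < t ->
  (\int[mu]_(s in `]Num.max t x, 1%R]) (n%:R * s ^- n.+1)%:E =
   (invpow_excess n t x)%:E)%E.
Proof.
move=> t0; set y := Num.max t x.
have y0 : 0 < y by rewrite lt_max t0.
rewrite /invpow_excess -/y; have [y1|y1] := ltP y 1.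
  rewrite integral_expVn// expr1n invr1; congr EFin; apply/esym/max_idPl.
  by rewrite subr_ge0 invf_ge1 ?exprn_gt0// exprn_ile1 ?ltW.
rewrite set_itv_ge ?integral_set0 -?leNgt ?bnd_simp//.
congr EFin; apply/esym/max_idPr.
by rewrite subr_le0 invf_le1 ?exprn_gt0// exprn_ege1.
Qed.

Lemma expectation_invpow_excess (n : nat) (t : R) : 0 < t ->
  (\int[P]_w (invpow_excess n t (X w))%:E =
   \int[mu]_(s in `]t, 1%R])
     ((n%:R * s ^- n.+1)%:E * P [set w | (X w < s)%R]))%E.
Proof.
move=> t0; rewrite -layer_cake//.
- by apply: eq_integral => w _; rewrite integral_expVn_invpow_excess.
- exact: measurable_expVn.
- move=> s; rewrite in_itv/= => /andP[ts _].
  by rewrite mulr_ge0// invr_ge0 exprn_ge0// ltW// (lt_trans t0).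
Qed.

Variables (c : R) (N : nat).
Hypothesis Xlaw : small_ball_law P X c N.

Let c0 : 0 <= c. Proof. exact: small_ball_law_ge0 Xlaw. Qed.

Let mcdf (n : nat) (t : R) : 0 < t -> measurable_fun `]t, 1]
  (fun s => (n%:R * s ^- n.+1)%:E * P [set w | (X w < s)%R])%E.
Proof.
move=> t0; apply: emeasurable_funM.
  by apply/measurable_EFinP; exact: measurable_expVn.
by apply: measurable_funTS; exact: measurable_cdf_lt.
Qed.

Lemma expectation_invpow_excess_le (n : nat) (t : R) : 0 < t ->
  (\int[P]_w (invpow_excess n t (X w))%:E <=
   \int[mu]_(s in `]t, 1%R]) (n%:R * s ^- n.+1 * (c * s ^+ N))%:E)%E.
Proof.
move=> t0; have [K _ PX] := Xlaw.
have s0 s : s \in `]t, 1] -> 0 < s.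
  by rewrite in_itv/= => /andP[/(lt_trans t0)].
rewrite expectation_invpow_excess//; apply: ge0_le_integral => //=.
- move=> s /s0/ltW s0'; rewrite mule_ge0// lee_fin mulr_ge0//.
  by rewrite invr_ge0 exprn_ge0.
- exact: mcdf.
- apply/measurable_EFinP; apply: measurable_funM; first exact: measurable_expVn.
  by apply: measurable_funM.
- move=> s /s0 s0'; have /andP[_ hi] := PX s s0'; rewrite [leRHS]EFinM.
  by apply: lee_wpmul2l hi; rewrite lee_fin mulr_ge0// invr_ge0 exprn_ge0// ltW.
Qed.

Lemma expectation_invpow_excess_ln_le (t : R) : 0 < t -> t < 1 ->
  (\int[P]_w (invpow_excess N t (X w))%:E <= (c * N%:R * - ln t)%:E)%E.
Proof.
move=> t0 t1; apply: le_trans (expectation_invpow_excess_le N t0) _.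
rewrite (_ : c * N%:R * - ln t = c * N%:R * (ln 1 - ln t)); last first.
  by rewrite ln1 sub0r.
rewrite -integral_inv// le_eqVlt; apply/orP; left; apply/eqP.
apply: eq_integral => s; rewrite inE/= in_itv/= => /andP[/(lt_trans t0) s0 _].
by congr EFin; rewrite exprS; field; rewrite expf_neq0 ?gt_eqF.
Qed.

Lemma expectation_invpow_excess_ln_ge :
  exists2 C : R, 0 <= C & forall t, 0 < t -> t < 1 ->
  ((c * N%:R * - ln t)%:E <= \int[P]_w (invpow_excess N t (X w))%:E + C%:E)%E.
Proof.
have [K K0 PX] := Xlaw; have cNK0 : 0 <= c * N%:R * K by rewrite !mulr_ge0.
exists (c * N%:R * K) => // t t0 t1.
apply: (@le_trans _ _ (\int[mu]_(s in `]t, 1%R])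
    ((N%:R * s ^- N.+1)%:E * P [set w | (X w < s)%R] + (c * N%:R * K)%:E))%E).
  rewrite (_ : c * N%:R * - ln t = c * N%:R * (ln 1 - ln t)); last first.
    by rewrite ln1 sub0r.
  rewrite -integral_inv//; apply: ge0_le_integral => //=.
  - move=> s; rewrite in_itv/= => /andP[/(lt_trans t0)/ltW s0 _].
    by rewrite lee_fin !mulr_ge0// invr_ge0.
  - by apply/measurable_EFinP; exact: (measurable_expVn _ 1).
  - by apply: emeasurable_funD => //; exact: mcdf.
  - move=> s; rewrite in_itv/= => /andP[/(lt_trans t0) s0 _].
    have /andP[+ _] := PX s s0; set p := P _ => lo.
    have w0 : 0 <= N%:R * s ^- N.+1
      by rewrite mulr_ge0// invr_ge0 exprn_ge0// ltW.
    apply: le_trans (leeD2r _ (lee_wpmul2l _ lo)); rewrite ?lee_fin//.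
    have -> : N%:R * s ^- N.+1 * (c * expR (- (K * s)) * s ^+ N) =
        c * N%:R * (expR (- (K * s)) / s).
      by rewrite exprS; field; rewrite expf_neq0 ?gt_eqF.
    rewrite -mulrDr ler_wpM2l ?mulr_ge0//.
    rewrite -(ler_pM2r s0) mulVf ?gt_eqF// mulrDl divfK ?gt_eqF//.
    by have := expR_ge1Dx (- (K * s)); lra.
rewrite ge0_integralD//; last 2 first.
- move=> s; rewrite /= in_itv/= => /andP[/(lt_trans t0)/ltW s0 _].
  by rewrite mule_ge0// lee_fin mulr_ge0// invr_ge0 exprn_ge0.
- exact: mcdf.
rewrite -expectation_invpow_excess// leeD2l// integral_cst//=.
rewrite lebesgue_measure_itv/= lte_fin t1 -EFinB -EFinM lee_fin.
by rewrite ler_piMr//; lra.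
Qed.

Lemma expectation_invpow_excessS_le (t : R) : 0 < t -> t < 1 ->
  (\int[P]_w (invpow_excess N.+1 t (X w))%:E <= (c * N.+1%:R / t)%:E)%E.
Proof.
move=> t0 t1; apply: le_trans (expectation_invpow_excess_le N.+1 t0) _.
apply: (@le_trans _ _ ((c * N.+1%:R)%:E * (t ^- 1 - 1 ^- 1)%:E)%E); last first.
  by rewrite -EFinM lee_fin invr1 expr1 ler_wpM2l ?mulr_ge0// lerBlDr lerDl.
rewrite -integral_expVn// -ge0_integralZl//; last 3 first.
- by apply/measurable_EFinP; exact: measurable_expVn.
- move=> s; rewrite /= in_itv/= => /andP[/(lt_trans t0)/ltW s0 _].
  by rewrite lee_fin mulr_ge0// invr_ge0 exprn_ge0.
- by rewrite lee_fin mulr_ge0.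
rewrite le_eqVlt; apply/orP; left; apply/eqP.
apply: eq_integral => s; rewrite inE/= in_itv/= => /andP[/(lt_trans t0) s0 _].
by rewrite -EFinM; congr EFin; rewrite !exprS expr0; field;
  rewrite expf_neq0 ?gt_eqF.
Qed.

End truncated_inverse_moments.

Lemma ge0_integral_affine (R : realType) (d : measure_display)
    (T : measurableType d) (P : probability T R) (f : T -> R) (u v : R) :
  measurable_fun setT f -> (forall w, 0 <= f w) -> 0 <= u -> 0 <= v ->
  (\int[P]_w (u + v * f w)%:E = u%:E + v%:E * \int[P]_w (f w)%:E)%E.
Proof.
move=> mf f0 u0 v0; under eq_integral do rewrite EFinD EFinM.
rewrite ge0_integralD//; last 2 first.
- by move=> w _; rewrite mule_ge0// lee_fin.
- by apply: emeasurable_funM => //; exact/measurable_EFinP.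
rewrite integral_cst//= probability_setT mule1 ge0_integralZl//.
  exact/measurable_EFinP.
by move=> w _; rewrite lee_fin.
Qed.

Section product_tail.
Context (R : realType) (d : measure_display) (T : measurableType d)
  (P : probability T R) (X Y : T -> R).
Hypotheses (mX : measurable_fun setT X) (mY : measurable_fun setT Y).
Hypothesis indXY : independent2 P X Y.
Variables (a b : R) (N : nat).
Hypotheses (Xlaw : small_ball_law P X a N) (Ylaw : small_ball_law P Y b N).

Let a0 : 0 <= a. Proof. exact: small_ball_law_ge0 Xlaw. Qed.
Let b0 : 0 <= b. Proof. exact: small_ball_law_ge0 Ylaw. Qed.

Let event (t : R) : set (R * R) := [set z | t <= z.1 /\ z.1 * z.2 < t].

Let event_preimage (t : R) : set T := [set w | t <= X w /\ X w * Y w < t].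

Let prob_given (t x : R) : \bar R :=
  if t <= x then P [set w | Y w < t / x] else 0%E.

Let measurable_event t : measurable (event t).
Proof.
rewrite (_ : event t = ~` [set z | z.1 < t] `&` [set z | z.1 * z.2 < t]).
  apply: measurableI; first apply: measurableC; apply: measurable_lt => //.
  exact: measurable_funM.
by apply/seteqP; split => z /= [tz ?]; split => //; move: tz;
  rewrite leNgt => /negP.
Qed.

Let probability_xsection_event t x : 0 < t ->
  P (Y @^-1` xsection (event t) x) = prob_given t x.
Proof.
move=> t0; rewrite /prob_given; case: leP => tx; last first.
  rewrite (_ : _ @^-1` _ = set0) ?measure0// -subset0 => w.
  by rewrite /xsection/= inE => -[/=]; rewrite leNgt tx.
congr (P _); apply/seteqP; split => w /=; rewrite /xsection/= inE /event/=;
  by rewrite ltr_pdivlMr ?(lt_le_trans t0)// mulrC; tauto.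
Qed.

Let probability_event_preimage t : 0 < t ->
  P (event_preimage t) = (\int[P]_w prob_given t (X w))%E.
Proof.
move=> t0; rewrite -[LHS]/(P [set w | event t (X w, Y w)]).
rewrite probability_independent2//; apply: eq_integral => w _.
exact: probability_xsection_event.
Qed.

Let prob_given_ge0 t x : (0 <= prob_given t x)%E.
Proof. by rewrite /prob_given; case: ifP. Qed.

Let measurable_prob_given t : 0 < t ->
  measurable_fun setT (fun w => prob_given t (X w)).
Proof.
move=> t0; have := measurable_probability_xsection P mX mY (measurable_event t).
by apply: eq_measurable_fun => w _; rewrite probability_xsection_event.
Qed.

Let prob_given_le t x : 0 < t ->
  (prob_given t x <= (b * t ^+ N + b * t ^+ N * invpow_excess N t x)%:E)%E.
Proof.
move=> t0; have bt0 : 0 <= b * t ^+ N by rewrite mulr_ge0// exprn_ge0// ltW.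
rewrite /prob_given; case: ifPn => [tx|_]; last first.
  by rewrite lee_fin addr_ge0// mulr_ge0// invpow_excess_ge0.
have x0 := lt_le_trans t0 tx; have [K _ PY] := Ylaw.
have /andP[_ hi] := PY (t / x) (divr_gt0 t0 x0).
apply: le_trans hi _; rewrite lee_fin expr_div_n mulrA.
by rewrite -[X in X + _ * _]mulr1 -mulrDr ler_wpM2l// invpow_le_excess.
Qed.

Let prob_given_ge : exists2 K : R, 0 <= K & forall t x, 0 < t ->
  ((b * t ^+ N * invpow_excess N t x)%:E <= prob_given t x +
    ((b * \1_[set y | y < t] x)%:E + (b * K * t ^+ N.+1 +
      b * K * t ^+ N.+1 * invpow_excess N.+1 t x)%:E))%E.
Proof.
have [K K0 PY] := Ylaw; exists K => // t x t0.
have bt0 : 0 <= b * t ^+ N by rewrite mulr_ge0// exprn_ge0// ltW.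
have slack0 : 0 <= b * K * t ^+ N.+1 +
    b * K * t ^+ N.+1 * invpow_excess N.+1 t x.
  by rewrite addr_ge0 ?mulr_ge0 ?exprn_ge0 ?invpow_excess_ge0// ltW.
have := invpow_excess_le N x t0; rewrite /prob_given.
have [tx|xt] := leP t x => excess_le.
  have x0 := lt_le_trans t0 tx.
  have /andP[lo _] := PY (t / x) (divr_gt0 t0 x0).
  rewrite indicE memNset /=; last by apply/negP; rewrite -leNgt.
  rewrite mulr0 add0e; apply: le_trans (leeD2r _ lo); rewrite -EFinD lee_fin.
  have bKt0 : 0 <= b * K * t ^+ N.+1 by rewrite !mulr_ge0// exprn_ge0// ltW.
  have := ler_wpM2l bKt0 (invpow_le_excess N.+1 tx).
  have := ler_wpM2l bt0 excess_le.
  have btx0 : 0 <= b * t ^+ N * x ^- N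
    by rewrite mulr_ge0// invr_ge0 exprn_ge0// ltW.
  have := ler_wpM2l btx0 (expR_ge1Dx (- (K * (t / x)))).
  set e := expR _.
  have -> : b * e * (t / x) ^+ N = b * t ^+ N * x ^- N * e.
    by rewrite expr_div_n; ring.
  have -> : b * K * t ^+ N.+1 * x ^- N.+1 = b * t ^+ N * x ^- N * (K * (t / x)).
    by rewrite !exprS; field; rewrite expf_neq0 ?gt_eqF.
  lra.
rewrite indicE mem_set//= mulr1 add0e -EFinD lee_fin.
apply: le_trans (ler_wpM2l bt0 excess_le) _.
by rewrite mulfK ?expf_neq0 ?gt_eqF// lerDl.
Qed.

Let measurable_excess n t : 0 < t ->
  measurable_fun setT (fun w => invpow_excess n t (X w)).
Proof. exact: measurable_invpow_excess. Qed.

Let measurable_event_preimage t : measurable (event_preimage t).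
Proof.
rewrite -[X in measurable X]setTI.
exact: (measurable_fun_pair mX mY measurableT (measurable_event t)).
Qed.

Lemma product_tail_le : exists C : R, forall t, 0 < t -> t < 1 ->
  (P [set w | (X w * Y w < t)%R] <=
    (t ^+ N * (N%:R * a * b * - ln t + C))%:E)%E.
Proof.
exists (a + b) => t t0 t1.
have mXt : measurable [set w | X w < t] by exact: measurable_lt.
apply: (@le_trans _ _ (P [set w | (X w < t)%R] +
    P (event_preimage t))%E).
  apply: le_trans (measureU2 _ mXt (measurable_event_preimage t));
    apply: le_measure; rewrite ?inE.
  - by apply: measurable_lt => //; exact: measurable_funM.
  - by apply: measurableU.
  - by move=> w /= XYt; have [] := leP t (X w); [right|left].
have bt0 : 0 <= b * t ^+ N by rewrite mulr_ge0// exprn_ge0// ltW.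
rewrite (_ : t ^+ N * _ = a * t ^+ N +
    (b * t ^+ N + b * t ^+ N * (a * N%:R * - ln t))); last by ring.
rewrite EFinD; apply: leeD.
  by have [K _ PX] := Xlaw; have /andP[_] := PX t t0.
rewrite probability_event_preimage//; apply: (@le_trans _ _ (\int[P]_w
    (b * t ^+ N + b * t ^+ N * invpow_excess N t (X w))%:E)%E).
  apply: ge0_le_integral => //.
  - exact: measurable_prob_given.
  - by apply/measurable_EFinP; apply: measurable_funD => //;
      apply: measurable_funM => //; exact: measurable_excess.
  - by move=> w _; exact: prob_given_le.
rewrite ge0_integral_affine// ?EFinD ?EFinM; last 2 first.
- exact: measurable_excess.
- by move=> w; exact: invpow_excess_ge0.
rewrite leeD2l// lee_wpmul2l ?lee_fin// -!EFinM.
exact: (expectation_invpow_excess_ln_le mX).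
Qed.

Let late (t : R) (w : T) : \bar R := (b * \1_[set y | y < t] (X w))%:E.

Let measurable_late t : measurable_fun setT (late t).
Proof.
have mXt : measurable [set w | X w < t] by exact: measurable_lt.
apply/measurable_EFinP; apply: measurable_funM => //.
exact: (@measurable_indic _ T R setT _ mXt).
Qed.

Let integral_late t :
  (\int[P]_w late t w = b%:E * P [set w | (X w < t)%R])%E.
Proof.
have mXt : measurable [set w | X w < t] by exact: measurable_lt.
rewrite -[in RHS](setIT [set w | X w < t]) -integral_indic//.
rewrite -ge0_integralZl//; apply/measurable_EFinP.
exact: (@measurable_indic _ T R setT _ mXt).
Qed.

Let expectation_excess_le : exists2 K : R, 0 <= K & forall t, 0 < t ->
  ((b * t ^+ N)%:E * \int[P]_w (invpow_excess N t (X w))%:E <=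
    P (event_preimage t) + (b%:E * P [set w | (X w < t)%R] +
    ((b * K * t ^+ N.+1)%:E + (b * K * t ^+ N.+1)%:E *
      \int[P]_w (invpow_excess N.+1 t (X w))%:E)))%E.
Proof.
have [K K0 prob_ge] := prob_given_ge; exists K => // t t0.
have bt0 : 0 <= b * t ^+ N by rewrite mulr_ge0// exprn_ge0// ltW.
have bKt0 : 0 <= b * K * t ^+ N.+1 by rewrite !mulr_ge0// exprn_ge0// ltW.
have mexcess n := measurable_excess n t0.
have excess0 n w : 0 <= invpow_excess n t (X w) := invpow_excess_ge0 n t (X w).
have mprob := measurable_prob_given t0.
have prob0 w := prob_given_ge0 t (X w).
have mlate := measurable_late t.
pose slack w := (b * K * t ^+ N.+1 +
  b * K * t ^+ N.+1 * invpow_excess N.+1 t (X w))%:E.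
have mslack : measurable_fun setT slack.
  by apply/measurable_EFinP; apply: measurable_funD => //;
    exact: measurable_funM.
have slack0 w : (0 <= slack w)%E by rewrite lee_fin addr_ge0// mulr_ge0.
have late0 w : (0 <= late t w)%E by rewrite lee_fin mulr_ge0.
have mbexcess : measurable_fun setT
    (fun w => (b * t ^+ N)%:E * (invpow_excess N t (X w))%:E)%E.
  by apply: emeasurable_funM => //; exact/measurable_EFinP.
rewrite -ge0_integral_affine// probability_event_preimage// -integral_late.
rewrite -ge0_integralZl//; last 2 first.
- exact/measurable_EFinP.
- by move=> w _; rewrite lee_fin.
rewrite -[X in (_ <= _ + (_ + X))%E]/(\int[P]_w slack w)%E.
rewrite -[X in (_ <= _ + X)%E]ge0_integralD// -ge0_integralD//; last 2 first.
- by move=> w _; rewrite adde_ge0.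
- exact: emeasurable_funD.
apply: ge0_le_integral => //.
- by move=> w _; rewrite mule_ge0 ?lee_fin.
- by apply: emeasurable_funD => //; exact: emeasurable_funD.
- by move=> w _; rewrite -EFinM; exact: prob_ge.
Qed.

Lemma product_tail_ge : exists C : R, forall t, 0 < t -> t < 1 ->
  ((t ^+ N * (N%:R * a * b * - ln t - C))%:E <=
    P [set w | (X w * Y w < t)%R])%E.
Proof.
have [K K0 excess_le] := expectation_excess_le.
have [C C0 excess_ge] := expectation_invpow_excess_ln_ge mX Xlaw.
exists (b * C + b * a + b * K * (1 + a * N.+1%:R)) => t t0 t1.
have bt0 : 0 <= b * t ^+ N by rewrite mulr_ge0// exprn_ge0// ltW.
have bKt0 : 0 <= b * K * t ^+ N.+1 by rewrite !mulr_ge0// exprn_ge0// ltW.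
apply: (@le_trans _ _ (P (event_preimage t))); last first.
  apply: le_measure; rewrite ?inE//; last by move=> w [].
  by apply: measurable_lt => //; exact: measurable_funM.
have [_ _ /(_ t t0)/andP[_ PXt]] := Xlaw.
have bKtN0 : 0 <= b * K * t ^+ N by rewrite !mulr_ge0// exprn_ge0// ltW.
apply: (@le_trans _ _ (b * t ^+ N * (a * N%:R * - ln t) -
    (b * (a * t ^+ N) + (b * K * t ^+ N.+1 + b * K * t ^+ N.+1 *
      (a * N.+1%:R / t)) + b * t ^+ N * C))%:E).
  rewrite lee_fin -subr_ge0 (_ : _ - _ = b * K * t ^+ N * (1 - t)).
    by rewrite mulr_ge0// subr_ge0 ltW.
  by rewrite exprS; field; rewrite gt_eqF.
rewrite EFinB leeBlDr// EFinD addeA.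
apply: (@le_trans _ _ ((b * t ^+ N)%:E *
    (\int[P]_w (invpow_excess N t (X w))%:E + C%:E))%E).
  by rewrite EFinM; apply: lee_wpmul2l; [rewrite lee_fin|exact: excess_ge].
rewrite ge0_muleDr ?integral_ge0//; last first.
  by move=> w _; rewrite lee_fin invpow_excess_ge0.
rewrite -EFinM leeD2r//; apply: le_trans (excess_le t t0) _.
rewrite leeD2l// EFinD leeD//; first by rewrite EFinM lee_wpmul2l ?lee_fin.
rewrite EFinD leeD2l// [leRHS]EFinM lee_wpmul2l ?lee_fin//.
exact: (expectation_invpow_excessS_le mX).
Qed.

End product_tail.

(** * Limits at infinity *)

Section logarithmic_limits.
Context (R : realType).

Lemma cvgy_ln : ln r @[r --> +oo] --> (+oo : set_system R).
Proof.
apply/cvgryPge => A; near=> r.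
have Ar : expR A <= r by near: r; apply: nbhs_pinfty_ge; exact: num_real.
have r0 : 0 < r := lt_le_trans (expR_gt0 A) Ar.
by rewrite -[A]expRK ler_ln ?posrE ?expR_gt0.
Unshelve. all: by end_near. Qed.

Lemma ln_pinfty_gt0 : \forall r \near +oo, 0 < (ln r : R).
Proof. by near=> r; apply: ln_gt0. Unshelve. all: by end_near. Qed.

Lemma cvg_affine_ln_ratio (c C : R) :
  (c * ln r + C) / ln r @[r --> +oo] --> c.
Proof.
have lnV0 : (ln r)^-1 @[r --> +oo] --> (0 : R).
  by apply/gtr0_cvgV0; [exact: ln_pinfty_gt0|exact: cvgy_ln].
have lim : c + C * (ln r)^-1 @[r --> +oo] --> c.
  rewrite -[X in _ --> X]addr0 -[X in _ + X](mulr0 C).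
  by apply: cvgD; [exact: cvg_cst|apply: cvgM; [exact: cvg_cst|]].
apply: cvg_trans lim; apply: near_eq_cvg.
near=> r; rewrite mulrDl mulfK// gt_eqF//.
by near: r; exact: ln_pinfty_gt0.
Unshelve. all: by end_near. Qed.

Lemma squeeze_cvg_at_right (T : Type) (F : set_system T) {FF : Filter F}
    (f lo : T -> R) (hi : R -> T -> R) (L : R -> R) (a : R) :
  L x @[x --> a^'+] --> L a -> lo t @[t --> F] --> L a ->
  (forall x, a < x -> hi x t @[t --> F] --> L x) ->
  (forall x, a < x -> \forall t \near F, lo t <= f t <= hi x t) ->
  f t @[t --> F] --> L a.
Proof.
move=> cL clo chi bounds; apply/cvgrPdist_le => e e0.
have e20 : 0 < e / 2 by rewrite divr_gt0.
have [x [ax Lx]] : exists x, a < x /\ `|L a - L x| <= e / 2.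
  near (a^'+) => x; exists x; split => //.
  by near: x; exact: cvgr_dist_le cL _ e20.
near=> t.
have /andP[lo_f f_hi] : lo t <= f t <= hi x t by near: t; exact: bounds.
have : `|L a - lo t| <= e by near: t; exact: cvgr_dist_le clo _ e0.
have : `|L x - hi x t| <= e / 2.
  by near: t; exact: cvgr_dist_le (chi x ax) _ e20.
move: Lx; rewrite !ler_distlC => /andP[_ Lx] /andP[_ hix] /andP[lot _].
by apply/andP; split; lra.
Unshelve. all: by end_near. Qed.

End logarithmic_limits.

Section scaled_product_tail.
Context (R : realType) (d : measure_display) (T : measurableType d)
  (P : probability T R) (X Y : T -> R).
Hypotheses (mX : measurable_fun setT X) (mY : measurable_fun setT Y).
Hypothesis indXY : independent2 P X Y.
Variables (a b : R) (N : nat).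
Hypotheses (Xlaw : small_ball_law P X a N) (Ylaw : small_ball_law P Y b N).

Lemma product_tail_cvg (k : R) : 0 < k ->
  r ^+ N / ln r * fine (P [set w | X w * Y w < k / r]) @[r --> +oo] -->
    (N%:R * a * b * k ^+ N).
Proof.
move=> k0; pose c := N%:R * a * b.
have [Clo lo] := product_tail_ge mX mY indXY Xlaw Ylaw.
have [Chi hi] := product_tail_le mX mY indXY Xlaw Ylaw.
pose bound C r := (c * k ^+ N * ln r + (C - c * ln k) * k ^+ N) / ln r.
apply: (squeeze_cvgr (f := bound (- Clo)) (h := bound Chi)); last 2 first.
- exact: cvg_affine_ln_ratio.
- exact: cvg_affine_ln_ratio.
near=> r.
have r0 : 0 < r by near: r; exact: nbhs_pinfty_gt.
have lnr0 : 0 < ln r by near: r; exact: ln_pinfty_gt0.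
have kr : k < r by near: r; apply: nbhs_pinfty_gt; exact: num_real.
have t0 : 0 < k / r by rewrite divr_gt0.
have t1 : k / r < 1 by rewrite ltr_pdivrMr// mul1r.
have mprod : measurable [set w | X w * Y w < k / r].
  by apply: measurable_lt => //; exact: measurable_funM.
have boundE C : bound C r =
    r ^+ N / ln r * ((k / r) ^+ N * (c * - ln (k / r) + C)).
  rewrite /bound ln_div ?posrE// expr_div_n.
  by field; rewrite expf_neq0 !gt_eqF.
have := lo _ t0 t1; have := hi _ t0 t1.
rewrite -(fineK (fin_num_measure P _ mprod)) !lee_fin => hi_r lo_r.
rewrite !boundE !ler_wpM2l// divr_ge0 ?exprn_ge0//; exact: ltW.
Unshelve. all: by end_near. Qed.

End scaled_product_tail.

Section outage_event.
Context (R : realType).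
Implicit Types g p s E : R.

Lemma snr_lt_of_product_lt g p s : 0 < g -> 0 <= p -> 0 <= s -> p < g ->
  p * s < g * (p + s + 1).
Proof. by move=> g0 p0 s0 pg; nra. Qed.

Lemma product_lt_of_snr_lt g p s E : 0 < g -> 1 < E ->
  (1 + g * E) / (E - 1) <= s -> p * s < g * (p + s + 1) -> p < g * E.
Proof.
move=> g0 E1; rewrite ler_pdivrMr ?subr_gt0// => sE pse.
have sg : 0 < s - g by nra.
by rewrite -(ltr_pM2r sg); nra.
Qed.

Lemma gammaIE (eta theta d1 d2 tau rho x y : R) : 0 < d1 -> 0 < d2 ->
  let p := eta * theta / (d1 `^ tau * d2 `^ tau) * rho * (x * y) in
  let s := (1 - theta) / d1 `^ tau * rho * x in
  gammaI eta theta d1 d2 tau rho x y = p * s / (p + s + 1).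
Proof.
move=> d10 d20 p s; rewrite /gammaI.
have -> : d1 `^ (2 * tau) = d1 `^ tau * d1 `^ tau.
  rewrite [2 * _]mulr_natl mulr2n powRD//.
  by apply/implyP => _; rewrite gt_eqF.
congr (_ / (_ + _ + 1)); rewrite /p /s; last 2 first.
- by ring.
- by ring.
have := powR_gt0 tau d10; have := powR_gt0 tau d20.
move: (d1 `^ tau) (d2 `^ tau) => D1 D2 D20 D10.
by field; rewrite !gt_eqF.
Qed.

Context (d : measure_display) (T : measurableType d) (P : probability T R).
Variables (X Y : T -> R).
Hypotheses (mX : measurable_fun setT X) (mY : measurable_fun setT Y).
Hypotheses (X0 : forall w, 0 <= X w) (Y0 : forall w, 0 <= Y w).
Hypothesis indXY : independent2 P X Y.
Variables (a b : R) (N : nat).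
Hypotheses (Xlaw : small_ball_law P X a N) (Ylaw : small_ball_law P Y b N).
Variables (kp ks g : R).
Hypotheses (kp0 : 0 < kp) (ks0 : 0 < ks) (g0 : 0 < g).

Definition snr_event (r : R) : set T :=
  [set w | (kp * r * (X w * Y w)) * (ks * r * X w) <
     g * (kp * r * (X w * Y w) + ks * r * X w + 1)].

Let measurable_lt_cst (f : T -> R) (t : R) :
  measurable_fun setT f -> measurable [set w | f w < t].
Proof. by move=> mf; exact: measurable_lt. Qed.

Let mXY : measurable_fun setT (fun w => X w * Y w).
Proof. exact: measurable_funM. Qed.

Let measurable_snr_event r : measurable (snr_event r).
Proof.
have mp : measurable_fun setT (fun w => kp * r * (X w * Y w)).
  exact: measurable_funM.
have ms : measurable_fun setT (fun w => ks * r * X w) by exact: measurable_funM.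
apply: measurable_lt; first exact: measurable_funM.
by apply: measurable_funM => //; apply: measurable_funD => //;
  exact: measurable_funD.
Qed.

Let product_lt_sub_snr_event r : 0 < r ->
  [set w | X w * Y w < g / kp / r] `<=` snr_event r.
Proof.
move=> r0 w; rewrite /= -mulrA -invfM ltr_pdivlMr ?mulr_gt0// mulrC => XYg.
by apply: snr_lt_of_product_lt => //; rewrite !mulr_ge0// ltW.
Qed.

Let snr_event_sub r E : 0 < r -> 1 < E ->
  snr_event r `<=` [set w | X w < (1 + g * E) / (E - 1) / ks / r] `|`
                   [set w | X w * Y w < g * E / kp / r].
Proof.
move=> r0 E1 w snr_w; rewrite /= -!mulrA -!invfM.
have [|gain_ge] := ltP (X w) ((1 + g * E) / ((E - 1) * (ks * r))).
  by left.
right; rewrite mulrA ltr_pdivlMr ?mulr_gt0// mulrC.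
apply: product_lt_of_snr_lt snr_w => //.
by move: gain_ge; rewrite invfM mulrA ler_pdivrMr ?mulr_gt0// [X w * _]mulrC.
Qed.

Let probability_le (E F : set T) : measurable E -> measurable F -> E `<=` F ->
  fine (P E) <= fine (P F).
Proof.
by move=> mE mF EF; rewrite fine_le ?fin_num_measure//; apply: le_measure;
  rewrite ?inE.
Qed.

Let small_gain_cvg (k : R) : 0 < k ->
  r ^+ N / ln r * fine (P [set w | X w < k / r]) @[r --> +oo] --> (0 : R).
Proof.
move=> k0; have [K _ PX] := Xlaw.
apply: (squeeze_cvgr (f := fun=> 0)
  (h := fun r => (0 * ln r + a * k ^+ N) / ln r)); last 2 first.
- exact: cvg_cst.
- exact: cvg_affine_ln_ratio.
near=> r.
have r0 : 0 < r by near: r; exact: nbhs_pinfty_gt.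
have lnr0 : 0 < ln r by near: r; exact: ln_pinfty_gt0.
have w0 : 0 <= r ^+ N / ln r by rewrite divr_ge0 ?exprn_ge0// ltW.
have mXk : measurable [set w | X w < k / r] by exact: measurable_lt_cst.
rewrite mulr_ge0 ?fine_ge0//= mul0r add0r.
have -> : a * k ^+ N / ln r = r ^+ N / ln r * (a * (k / r) ^+ N).
  by rewrite expr_div_n; field; rewrite expf_neq0 !gt_eqF.
rewrite ler_wpM2l// -lee_fin fineK ?fin_num_measure//.
by have /andP[] := PX _ (divr_gt0 k0 r0).
Unshelve. all: by end_near. Qed.

Lemma snr_event_cvg :
  r ^+ N / ln r * fine (P (snr_event r)) @[r --> +oo] -->
    (N%:R * a * b * (g / kp) ^+ N).
Proof.
pose L E := N%:R * a * b * (g * E / kp) ^+ N.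
pose hi E r :=
  r ^+ N / ln r *
    fine (P [set w | X w < (1 + g * E) / (E - 1) / ks / r]) +
  r ^+ N / ln r * fine (P [set w | X w * Y w < g * E / kp / r]).
have L1 : L 1 = N%:R * a * b * (g / kp) ^+ N by rewrite /L mulr1.
rewrite -L1; apply: (squeeze_cvg_at_right (hi := hi)
  (lo := fun r => r ^+ N / ln r * fine (P [set w | X w * Y w < g / kp / r]))).
- apply: cvgM; first exact: cvg_cst.
  apply: (cvg_comp _ (fun x => x ^+ N)); last exact: exprn_continuous.
  apply: cvgM; last exact: cvg_cst.
  apply: cvgM; first exact: cvg_cst.
  exact: cvg_at_right_filter.
- by rewrite L1; apply: product_tail_cvg => //; exact: divr_gt0.
- move=> E E1; rewrite -[L E]add0r.
  have gE0 : 0 < g * E by rewrite mulr_gt0// (lt_trans ltr01).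
  apply: cvgD; first apply: small_gain_cvg.
    by rewrite !divr_gt0 ?subr_gt0// addr_gt0.
  by apply: product_tail_cvg => //; exact: divr_gt0.
move=> E E1; near=> r.
have r0 : 0 < r by near: r; exact: nbhs_pinfty_gt.
have lnr0 : 0 < ln r by near: r; exact: ln_pinfty_gt0.
have w0 : 0 <= r ^+ N / ln r by rewrite divr_ge0 ?exprn_ge0// ltW.
have mXS := measurable_lt_cst ((1 + g * E) / (E - 1) / ks / r) mX.
have mXYE := measurable_lt_cst (g * E / kp / r) mXY.
have msnr := measurable_snr_event r.
rewrite /hi -mulrDr; apply/andP; split; rewrite ler_wpM2l//.
  apply: probability_le => //; first exact: measurable_lt_cst.
  exact: product_lt_sub_snr_event.
apply: (le_trans (probability_le msnr _ (snr_event_sub r0 E1))) => //.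
  exact: measurableU.
rewrite -fineD ?fin_num_measure// fine_le ?fin_numD ?fin_num_measure//.
  exact: measurableU.
exact: measureU2.
Unshelve. all: by end_near. Qed.

End outage_event.

(** * Asymptotics of the closed form *)

Section lagrange.
Context (F : fieldType) (n : nat) (x : 'I_n -> F).
Hypothesis x_inj : injective x.

Let node_diff (i : 'I_n) : F := \prod_(j < n | j != i) (x i - x j).

Let node_diff_neq0 i : node_diff i != 0.
Proof. by apply/prodf_neq0 => j; rewrite subr_eq0 (inj_eq x_inj) eq_sym. Qed.

(* [lagrange_gen] of [qpoly] needs an injective family of nodes indexed
   by [nat]. *)
Lemma lagrange_interpolation (p : {poly F}) : (size p <= n)%N ->
  p = \sum_i (p.[x i] / node_diff i) *:
        \prod_(j < n | j != i) ('X - (x j)%:P).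
Proof.
move=> p_size; set q := \sum_i _.
have q_size : (size q <= n)%N.
  apply: leq_trans (size_sum _ _ _) _; apply/bigmax_leqP => i _.
  apply: leq_trans (size_scale_leq _ _) _.
  rewrite size_prod => [|j _]; last by rewrite polyXsubC_eq0.
  under eq_bigr do rewrite size_XsubC.
  rewrite sum_nat_const cardC1 card_ord muln2 -addnn -addSn addnK prednK//.
  exact: leq_ltn_trans (leq0n i) (ltn_ord i).
have qx k : q.[x k] = p.[x k].
  rewrite /q horner_sum (bigD1 k)//= hornerZ horner_prod.
  rewrite [X in _ + X]big1 ?addr0 => [|i ik].
    under eq_bigr do rewrite hornerXsubC.
    by rewrite divfK.
  rewrite hornerZ horner_prod (bigD1 k) 1?eq_sym//=.
  by rewrite hornerXsubC subrr mul0r mulr0.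
apply/eqP; rewrite -subr_eq0; apply/eqP.
apply: (@roots_geq_poly_eq0 _ _ [seq x k | k <- enum 'I_n]).
- apply/allP => _ /mapP[k _ ->].
  by rewrite rootE hornerD hornerN qx subrr.
- by rewrite map_inj_uniq ?enum_uniq.
- rewrite size_map size_enum_ord (leq_trans (size_polyD _ _))//.
  by rewrite geq_max p_size size_polyN.
Qed.

(* Lagrange interpolation of the constant polynomial [1], evaluated at [0]. *)
Lemma sum_inv_node_diff : (0 < n)%N -> (forall k, x k != 0) ->
  \sum_i (x i)^-1 / \prod_(j < n | j != i) (x i - x j) =
  (-1) ^+ n.-1 / \prod_i x i.
Proof.
move=> n0 x0; have size1 : (size (1%R : {poly F}) <= n)%N by rewrite size_poly1.
have prodx0 : \prod_i x i != 0 by apply/prodf_neq0 => i _.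
apply: (mulIf prodx0); rewrite divfK// mulr_suml.
have := congr1 (fun p : {poly F} => (-1) ^+ n.-1 * p.[0])
  (lagrange_interpolation size1).
rewrite hornerC mulr1 => ->; rewrite horner_sum mulr_sumr.
apply: eq_bigr => i _; rewrite hornerZ hornerC horner_prod.
under [in RHS]eq_bigr do rewrite hornerXsubC sub0r -mulN1r.
rewrite big_split/= prodr_const cardC1 card_ord [X in _ = _ * X]mulrCA signrMK.
rewrite [X in _ * X = _](bigD1 i)//= -/(node_diff i).
by field; rewrite node_diff_neq0 x0.
Qed.

End lagrange.

Section closed_form.
Context (R : realType) (N : nat) (lam sig : 'I_N -> R)
  (eta theta d1 d2 tau gth : R).

Definition leading_coef : R :=
  N%:R * (N`!%:R * \prod_i lam i)^-1 * (N`!%:R * \prod_i sig i)^-1 *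
  (gth / (eta * theta / (d1 `^ tau * d2 `^ tau))) ^+ N.

Hypotheses (N0 : (0 < N)%N) (d10 : 0 < d1) (gth0 : 0 < gth).
Hypotheses (lam0 : forall k, 0 < lam k) (sig0 : forall k, 0 < sig k).

Lemma leading_coef_gt0 : 0 < eta -> 0 < theta -> 0 < d2 -> 0 < leading_coef.
Proof.
have prod_gt0 (f : 'I_N -> R) : (forall k, 0 < f k) ->
    0 < (N`!%:R * \prod_i f i)^-1.
  by move=> f0; rewrite invr_gt0 mulr_gt0 ?ltr0n ?fact_gt0 ?prodr_gt0.
move=> eta0 theta0 d20; rewrite !mulr_gt0 ?prod_gt0 ?ltr0n ?exprn_gt0//.
by rewrite !divr_gt0 ?mulr_gt0 ?powR_gt0.
Qed.

Hypotheses (theta1 : theta < 1).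
Hypotheses (lam_inj : injective lam) (sig_inj : injective sig).

Let lam_weight i := (lam i)^-1 / \prod_(j < N | j != i) (lam i - lam j).
Let sig_weight m := (sig m)^-1 / \prod_(n < N | n != m) (sig m - sig n).
Let weight i m :=
  lam_weight i * sig_weight m * N`!%:R^-1 * (gth * d1 `^ tau) ^+ N.
Let slope : R := (N.-1)`!%:R^-1 * (d2 `^ tau / (eta * theta)) ^+ N.
Let offset i m : R :=
  slope * (Defs.harmonic N.-1 - euler_mascheroni +
    ln ((1 - theta) * lam i / (gth * d1 `^ tau))) -
  (- sig m / (1 - theta)) ^+ N.

Let sum_weight :
  \sum_i \sum_m weight i m * slope = leading_coef.
Proof.
have weight_sums : (\sum_i lam_weight i) * (\sum_m sig_weight m) =
    (\prod_i lam i)^-1 * (\prod_i sig i)^-1.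
  rewrite !sum_inv_node_diff// => [|k|k]; last 2 first.
  - by rewrite gt_eqF.
  - by rewrite gt_eqF.
  by rewrite mulrACA -expr2 sqrr_sign mul1r.
transitivity ((\sum_i lam_weight i) * (\sum_m sig_weight m) *
    (N`!%:R^-1 * (gth * d1 `^ tau) ^+ N * slope)).
  rewrite big_distrlr/= mulr_suml; apply: eq_bigr => i _.
  by rewrite mulr_suml; apply: eq_bigr => m _; rewrite /weight; ring.
have factE : N`!%:R = N%:R * (N.-1)`!%:R :> R.
  by rewrite -natrM -{1 2}(prednK N0) factS prednK.
have N_neq0 : (N%:R : R) != 0 by rewrite pnatr_eq0 -lt0n.
have -> : leading_coef = N%:R * (N`!%:R * \prod_i lam i)^-1 *
    (N`!%:R * \prod_i sig i)^-1 *
    ((gth * d1 `^ tau) ^+ N * (d2 `^ tau / (eta * theta)) ^+ N).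
  by rewrite /leading_coef -exprMn invf_div; congr (_ * _ ^+ N); ring.
rewrite weight_sums /slope factE !invfM.
move: (_ ^+ N) (_ ^+ N) (_`!%:R^-1) (\prod_i _)^-1 (\prod_i _)^-1.
by move=> *; field.
Qed.

Let A_asymE rho : 0 < rho -> A_asym lam sig eta theta d1 d2 tau gth rho =
  (\sum_i \sum_m weight i m * (slope * ln rho + offset i m)) / rho ^+ N.
Proof.
move=> rho0; have D10 : 0 < d1 `^ tau by exact: powR_gt0.
rewrite mulr_suml; apply: eq_bigr => i _; rewrite mulr_suml.
apply: eq_bigr => m _; rewrite /weight /offset /slope.
have -> : ln ((1 - theta) * rho * lam i / (gth * d1 `^ tau)) =
    ln rho + ln ((1 - theta) * lam i / (gth * d1 `^ tau)).
  rewrite -lnM ?posrE// ?divr_gt0 ?mulr_gt0 ?subr_gt0//.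
  by congr ln; ring.
rewrite -/(lam_weight i) -/(sig_weight m) [(gth * _ / rho) ^+ N]expr_div_n.
by ring.
Qed.

Lemma A_asym_cvg :
  rho ^+ N / ln rho * A_asym lam sig eta theta d1 d2 tau gth rho
    @[rho --> +oo] --> leading_coef.
Proof.
have lim : \sum_i \sum_m weight i m * ((slope * ln rho + offset i m) / ln rho)
    @[rho --> +oo] --> \sum_i \sum_m weight i m * slope.
  apply: cvg_big => [|i _]; first exact: add_continuous.
  apply: cvg_big => [|m _]; first exact: add_continuous.
  by apply: cvgM; [exact: cvg_cst|exact: cvg_affine_ln_ratio].
rewrite -sum_weight; apply: cvg_trans lim; apply: near_eq_cvg; near=> rho.
have rho0 : 0 < rho by near: rho; exact: nbhs_pinfty_gt.
have lnrho0 : 0 < ln rho by near: rho; exact: ln_pinfty_gt0.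
rewrite A_asymE//=.
transitivity
  ((\sum_i \sum_m weight i m * (slope * ln rho + offset i m)) / ln rho).
  rewrite mulr_suml; apply: eq_bigr => i _; rewrite mulr_suml.
  by apply: eq_bigr => m _; rewrite mulrA.
by move: (\sum_i _) => sum; field; rewrite expf_neq0 !gt_eqF.
Unshelve. all: by end_near. Qed.

End closed_form.

(** * The fading channel *)

Section channel_gain.
Context (R : realType) (d : measure_display) (T : measurableType d)
  (P : probability T R) (I : finType) (X : I -> T -> R) (n : nat)
  (U : 'M[R[i]]_n) (lam : 'I_n -> R) (iota : bool * 'I_n -> I).

Definition channel_gain (w : T) : R := sqnorm (sqrtm_of U lam *m gvec X iota w).

Lemma channel_gain_ge0 w : 0 <= channel_gain w.
Proof. exact: sqnorm_ge0. Qed.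

Lemma measurable_channel_gain (J : {set I}) : (forall p, iota p \in J) ->
  measurable_fun setT (channel_gain : subfamily X J -> R).
Proof.
move=> iJ; rewrite (_ : channel_gain = fun w =>
    qf (ctrmx (sqrtm_of U lam) *m sqrtm_of U lam) (gvec X iota w)); last first.
  by apply/funext => w; exact: sqnorm_mulmx.
by apply: measurable_qf => k; exact: cmeasurable_gvec.
Qed.

Lemma small_ball_law_channel_gain (M : 'M[R[i]]_n) :
  eigendecomp M U lam -> (forall k, 0 < lam k) ->
  (forall i, measurable_fun setT (X i)) -> mutually_independent P X ->
  (forall i, has_normal_law P (X i) 0 (Num.sqrt 2^-1)) -> injective iota ->
  small_ball_law P channel_gain (n`!%:R * \prod_k lam k)^-1 n.
Proof.
move=> eigM lam0 mX indX lawX iota_inj.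
rewrite (_ : channel_gain = fun w => qf M (gvec X iota w)); last first.
  by apply/funext => w; exact: sqnorm_sqrtm_of.
have := small_ball_law_qf mX indX lawX
  (posdefmx_eigendecomp eigM lam0) iota_inj.
by rewrite (det_eigendecomp eigM).
Qed.

End channel_gain.

Section outage_probability.
Context (R : realType) (d : measure_display) (T : measurableType d)
  (P : probability T R) (N : nat) (eta theta d1 d2 tau gth : R)
  (Rr Rt Ur Ut : 'M[R[i]]_N) (lam sig : 'I_N -> R)
  (re1 im1 re2 im2 : 'I_N -> T -> R).
Hypotheses (eta0 : 0 < eta) (theta0 : 0 < theta) (theta1 : theta < 1)
  (d10 : 0 < d1) (d20 : 0 < d2) (gth0 : 0 < gth).
Hypotheses (lam0 : forall k, 0 < lam k) (sig0 : forall k, 0 < sig k).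
Hypotheses (eigr : eigendecomp Rr Ur lam) (eigt : eigendecomp Rt Ut sig).
Hypothesis iid : iid_CSCG_pair P re1 im1 re2 im2.

Let Z := coords re1 im1 re2 im2.
Let iota (b : bool) (p : bool * 'I_N) : bool * bool * 'I_N := (b, p.1, p.2).
Let gain (b : bool) (U : 'M[R[i]]_N) (f : 'I_N -> R) :=
  channel_gain Z U f (iota b).
Let gain1 := gain true Ur lam.
Let gain2 := gain false (map_mx (@conjc R) Ut) sig.
Let kp := eta * theta / (d1 `^ tau * d2 `^ tau).
Let ks := (1 - theta) / d1 `^ tau.

Let kp0 : 0 < kp. Proof. by rewrite divr_gt0 ?mulr_gt0 ?powR_gt0. Qed.
Let ks0 : 0 < ks. Proof. by rewrite divr_gt0 ?subr_gt0 ?powR_gt0. Qed.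

Lemma outageE (rho : R) : 0 < rho ->
  outage P (sqrtm_of Ur lam) (sqrtm_of Ut sig) re1 im1 re2 im2
    eta theta d1 d2 tau gth rho =
  fine (P (snr_event gain1 gain2 kp ks gth rho)).
Proof.
move=> rho0; congr (fine (P _)); apply/funext => w.
have gain2E : sqnorm (rvec_of re2 im2 w *m sqrtm_of Ut sig) = gain2 w.
  rewrite sqnorm_mulmx_sqrtm_of; congr (sqnorm (_ *m _)).
  by apply/matrixP => i j; rewrite !mxE.
have p0 : 0 <= kp * rho * (gain1 w * gain2 w).
  by rewrite mulr_ge0// mulr_ge0 ?channel_gain_ge0// ltW.
have s0 : 0 <= ks * rho * gain1 w.
  by rewrite mulr_ge0 ?channel_gain_ge0// mulr_ge0// ltW.
rewrite /= gain2E -/(gain1 w) gammaIE// -/kp -/ks ltr_pdivrMr//.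
by rewrite ltr_wpDl// addr_ge0.
Qed.

Lemma outage_cvg :
  rho ^+ N / ln rho * outage P (sqrtm_of Ur lam) (sqrtm_of Ut sig)
    re1 im1 re2 im2 eta theta d1 d2 tau gth rho @[rho --> +oo] -->
  leading_coef lam sig eta theta d1 d2 tau gth.
Proof.
have [mZ [indZ lawZ]] := iid.
pose J b : {set bool * bool * 'I_N} := [set z | z.1.1 == b]%SET.
have mgain b U f : measurable_fun setT (gain b U f : subfamily Z (J b) -> R).
  by apply: measurable_channel_gain => p; rewrite inE.
have mgainT b U f : measurable_fun setT (gain b U f).
  exact: (measurable_fun_subfamily mZ (mgain b U f)).
have ind : independent2 P gain1 gain2.
  apply: (independent2_subfamilies mZ indZ _ (mgain _ _ _) (mgain _ _ _)).
  by rewrite disjoint_subset; apply/fintype.subsetP => z;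
    rewrite !inE => /eqP->.
have iota_inj b : injective (iota b) by move=> [? ?] [? ?] [-> ->].
have law1 : small_ball_law P gain1 (N`!%:R * \prod_k lam k)^-1 N.
  exact: small_ball_law_channel_gain eigr lam0 mZ indZ lawZ (iota_inj true).
have law2 : small_ball_law P gain2 (N`!%:R * \prod_k sig k)^-1 N.
  exact: small_ball_law_channel_gain (eigendecomp_tr eigt) sig0 mZ indZ lawZ
    (iota_inj false).
have := snr_event_cvg (mgainT _ _ _) (mgainT _ _ _) (channel_gain_ge0 _ _ _ _)
  (channel_gain_ge0 _ _ _ _) ind law1 law2 kp0 ks0 gth0.
move=> lim; apply: cvg_trans lim; apply: near_eq_cvg; near=> rho.
have rho0 : 0 < rho by near: rho; exact: nbhs_pinfty_gt.
by rewrite outageE.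
Unshelve. all: by end_near. Qed.

End outage_probability.

Theorem theorem3 (R : realType) (d : measure_display) (T : measurableType d)
    (P : probability T R) (N : nat) (eta theta d1 d2 tau gth : R)
    (Rr Rt Ur Ut : 'M[R[i]]_N) (lam sig : 'I_N -> R)
    (re1 im1 re2 im2 : 'I_N -> T -> R) :
  (1 <= N)%N ->
  0 < eta -> eta <= 1 -> 0 < theta -> theta < 1 ->
  0 < d1 -> 0 < d2 -> 0 < tau -> 0 < gth ->
  (forall k, 0 < lam k) -> (forall k, 0 < sig k) ->
  eigendecomp Rr Ur lam -> eigendecomp Rt Ut sig ->
  injective lam -> injective sig ->
  iid_CSCG_pair P re1 im1 re2 im2 ->
  (outage P (sqrtm_of Ur lam) (sqrtm_of Ut sig) re1 im1 re2 im2
       eta theta d1 d2 tau gth rho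
     / A_asym lam sig eta theta d1 d2 tau gth rho)
    @[rho --> +oo] --> (1 : R).
Proof.
move=> N0 eta0 _ theta0 theta1 d10 d20 _ gth0 lam0 sig0 eigr eigt.
move=> lam_inj sig_inj iid.
set c := leading_coef lam sig eta theta d1 d2 tau gth.
have out_cvg := outage_cvg (tau := tau) eta0 theta0 theta1 d10 d20 gth0
  lam0 sig0 eigr eigt iid.
have A_cvg := A_asym_cvg (eta := eta) (d2 := d2) (tau := tau)
  N0 d10 gth0 lam0 sig0 theta1 lam_inj sig_inj.
have c0 : c != 0 by rewrite gt_eqF// leading_coef_gt0.
rewrite -[1](divff c0); apply: cvg_trans (cvgM out_cvg (cvgV c0 A_cvg)).
apply: near_eq_cvg; near=> rho.
have weight_neq0 : rho ^+ N / ln rho != 0.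
  rewrite gt_eqF// divr_gt0 ?exprn_gt0//.
  by near: rho; exact: ln_pinfty_gt0.
by rewrite /= invfM mulrACA divff// mul1r.
Unshelve. all: by end_near. Qed.
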